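(* Let $d\in\mathbb{N}$, let $\bar A,A_1,\dots,A_d:V\to V'$ be the operators associated with a uniformly elliptic affine parametric diffusion coefficient $a(x,y)=\bar a(x)-\sum_{i=1}^d y_i\psi_i(x)$ on $D\times U$, $U=[-1,1]^d$, $V=H^1_0(D)$, and let $u(y)\in V$ solve $(\bar A-\sum_{i=1}^d y_iA_i)u(y)=f$ with $f\in V'$. Let $u_k(y)=\sum_{|\nu|\le k}t_\nu y^\nu$ be the truncated Taylor series of $u$. Suppose that $$\sum_{i=1}^dA_i=\theta\bar A$$ for some $\theta\in\,]0,1[$. Then for each $k\in\mathbb{N}$ there exist $v_\ell\in V$ and $d$-variate polynomials $\phi_{k,\ell}$, $\ell=1,\dots,n(d-1,k)$, such that $$u_k(y)=\sum_{\ell=1}^{n(d-1,k)}\phi_{k,\ell}(y)\,v_\ell,\qquad y\in U,$$ and therefore $\operatorname{rank}(u_k)\le n(d-1,k)\le(k+1)^{d-1}$.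
   Context: $D\subset\mathbb{R}^m$ is a bounded domain, $V=H^1_0(D)$, $V'$ its dual. The functions $\bar a,\psi_1,\dots,\psi_d\in L^\infty(D)$ are such that for some $0<r\le R<\infty$ one has $r\le a(x,y)\le R$ for all $x\in D$, $y\in U=[-1,1]^d$. The operators are $\langle\bar Au,v\rangle=\int_D\bar a\,\nabla u\cdot\nabla v\,dx$ and $\langle A_iu,v\rangle=\int_D\psi_i\nabla u\cdot\nabla v\,dx$. The Taylor coefficients are $t_\nu=\frac1{\nu!}\partial^\nu u(0)\in V$ for $\nu\in\mathbb{N}_0^d$, with $|\nu|=\sum_i\nu_i$, $y^\nu=\prod_iy_i^{\nu_i}$; equivalently $u_k(y)=\sum_{\ell=0}^k\big(\sum_{i=1}^dy_i\bar A^{-1}A_i\big)^\ell\bar A^{-1}f$. Notation: $n(d,k):=\binom{k+d}{d}$. For $w\in L^2(U,V,\mu)$, where $\mu$ is a given probability measure on $U$ (e.g. the uniform one), $\operatorname{rank}(w)$ is the dimension of the range of $\mathcal{M}_w:L^2(U,\mu)\to V$, $\mathcal{M}_w\varphi=\int_Uw(y)\varphi(y)\,d\mu(y)$. *)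

(* Defs.v *)
From HB Require Import structures.
From mathcomp Require Import all_boot all_order all_algebra.
From mathcomp Require Import generic_quotient ring_quotient.
From mathcomp Require Import all_classical all_reals all_analysis.
From mathcomp Require mpoly.
From mathcomp Require Import ring lra.

Set Implicit Arguments.
Unset Strict Implicit.
Unset Printing Implicit Defensive.

Import Order.TTheory GRing.Theory Num.Theory.
Import numFieldNormedType.Exports.

Local Open Scope classical_set_scope.
Local Open Scope ring_scope.

Definition measure_rV_display : measure_display.
Proof. exact: measure_tuple_display default_measure_display. Qed.

(* R^n, as 'rV[R]_n, with the sigma-algebra generated by the coordinates, i.e.
   the Borel sets. *)
Section measurable_rV.
Context {R : realType} {n : nat}.

Let coord : 'I_n -> 'rV[R]_n -> measurableTypeR R := fun i x => x ord0 i.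

Let rV_set0 : g_sigma_preimage coord set0.
Proof. exact: sigma_algebra0. Qed.

Let rV_setC A : g_sigma_preimage coord A -> g_sigma_preimage coord (~` A).
Proof. exact: sigma_algebraC. Qed.

Let rV_bigcup (F : _^nat) : (forall i, g_sigma_preimage coord (F i)) ->
  g_sigma_preimage coord (\bigcup_i (F i)).
Proof. exact: sigma_algebra_bigcup. Qed.

HB.instance Definition _ := @isMeasurable.Build measure_rV_display
  'rV[R]_n (g_sigma_preimage coord) rV_set0 rV_setC rV_bigcup.

End measurable_rV.

Section lebesgue_rV.
Context {R : realType}.

Lemma measurable_coord n (i : 'I_n) :
  measurable_fun [set: 'rV[R]_n] (fun x => x ord0 i : measurableTypeR R).
Proof.
move=> _ Y mY; rewrite setTI; apply: sub_sigma_algebra => /=.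
rewrite -bigcup_seq/=; exists i => /=; first by rewrite mem_index_enum.
by exists Y => //; rewrite setTI.
Qed.

Lemma measurable_fun_rVP d (T : measurableType d) n (f : T -> 'rV[R]_n) :
  (forall i, measurable_fun [set: T] (fun x => f x ord0 i : measurableTypeR R)) ->
  measurable_fun [set: T] f.
Proof.
move=> mf; apply: (@measurability _ _ _ _ setT f
  (\big[setU/set0]_(i < n) preimage_set_system setT
     (fun x : 'rV[R]_n => x ord0 i : measurableTypeR R) measurable)) => //.
move=> _ [B + <-]; rewrite -bigcup_seq => -[i _ [C mC <-]].
rewrite !setTI; have := mf i measurableT C mC.
by rewrite setTI.
Qed.

Definition consrV n (p : measurableTypeR R * 'rV[R]_n) : 'rV[R]_n.+1 :=
  \row_i oapp (fun j => p.2 ord0 j) p.1 (unlift ord0 i).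

Lemma measurable_consrV n : measurable_fun setT (@consrV n).
Proof.
apply: measurable_fun_rVP => i; rewrite /consrV.
under eq_fun do rewrite mxE.
case: unliftP => [j|] _ /=; last exact: measurable_fst.
by apply: (measurableT_comp (@measurable_coord n j)).
Qed.

Definition splitrV n (x : 'rV[R]_n.+1) : measurableTypeR R * 'rV[R]_n :=
  (x ord0 ord0, \row_j x ord0 (lift ord0 j)).

Lemma consrVK n : cancel (@consrV n) (@splitrV n).
Proof.
move=> [a x]; rewrite /splitrV /consrV mxE unlift_none; congr pair.
by apply/rowP => j; rewrite !mxE liftK.
Qed.

Lemma measurable_splitrV n : measurable_fun setT (@splitrV n).
Proof.
apply: measurable_fun_pair; first exact: measurable_coord.
apply: measurable_fun_rVP => i; under eq_fun do rewrite mxE.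
exact: (@measurable_coord n.+1).
Qed.

Section lebesgueS.
Variables (n : nat) (mu : {sigma_finite_measure set 'rV[R]_n -> \bar R}).

Definition lebesgueS : set 'rV[R]_n.+1 -> \bar R :=
  pushforward (lebesgue_measure \x mu)%E (@consrV n).

Let lebesgueS0 : (lebesgueS set0 = 0)%E.
Proof. by rewrite /lebesgueS /pushforward preimage_set0 measure0. Qed.

Let lebesgueS_ge0 A : (0 <= lebesgueS A)%E.
Proof. rewrite /lebesgueS /pushforward; exact: measure_ge0. Qed.

Let lebesgueS_sigma_additive : semi_sigma_additive lebesgueS.
Proof.
move=> F mF tF mUF; rewrite /lebesgueS /pushforward preimage_bigcup.
apply: measure_semi_sigma_additive.
- by move=> k; rewrite -[X in measurable X]setTI; exact: measurable_consrV.
- apply/trivIsetP => /= i j _ _ ij; rewrite -preimage_setI.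
  by move/trivIsetP : tF => /(_ _ _ _ _ ij) ->//; rewrite preimage_set0.
- by rewrite -preimage_bigcup -[X in measurable X]setTI;
    exact: measurable_consrV.
Qed.

HB.instance Definition _ := isMeasure.Build _ _ _ lebesgueS
  lebesgueS0 lebesgueS_ge0 lebesgueS_sigma_additive.

Let lebesgueS_sigma_finite : sigma_finite setT lebesgueS.
Proof.
have /sigma_finiteP[F [TF ndF Foo]] := sigma_finiteT (@lebesgue_measure R).
have /sigma_finiteP[G [TG ndG Goo]] := sigma_finiteT mu.
exists (fun k => @splitrV n @^-1` (F k `*` G k)).
  rewrite -preimage_bigcup; apply/esym/seteqP; split=> // x _ /=.
  have [i _ Fi] : (\bigcup_i F i) (splitrV x).1 by rewrite -TF.
  have [j _ Gj] : (\bigcup_i G i) (splitrV x).2 by rewrite -TG.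
  exists (maxn i j) => //; split.
    by move: Fi; exact/subsetPset/ndF/leq_maxl.
  by move: Gj; exact/subsetPset/ndG/leq_maxr.
move=> k; have [mF Fk] := Foo k; have [mG Gk] := Goo k; split.
  rewrite -[X in measurable X]setTI; apply: measurable_splitrV => //.
  exact: measurableX.
rewrite /lebesgueS /pushforward -comp_preimage.
rewrite (_ : @splitrV n \o @consrV n = id); last first.
  by apply/funext => p /=; rewrite consrVK.
by rewrite preimage_id product_measure1E// lte_mul_pinfty// ge0_fin_numE.
Qed.

HB.instance Definition _ := Measure_isSigmaFinite.Build _ _ _ lebesgueS
  lebesgueS_sigma_finite.

End lebesgueS.

(* Lebesgue measure on R^n: iterated product of the measure on R; see
   lebesgue_rV_box for its value on boxes. *)
Fixpoint lebesgue_rV n : {sigma_finite_measure set 'rV[R]_n -> \bar R} :=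
  if n is n'.+1 then lebesgueS (lebesgue_rV n') else \d_(0 : 'rV[R]_0).

End lebesgue_rV.

Lemma lebesgue_rV_box (R : realType) n (a b : 'rV[R]_n) :
  (forall i, a ord0 i <= b ord0 i) ->
  lebesgue_rV n [set x : 'rV[R]_n | forall i, a ord0 i <= x ord0 i <= b ord0 i] =
  (\prod_(i < n) (b ord0 i - a ord0 i))%:E.
Proof.
elim: n a b => [|n IH] a b ab.
  by rewrite big_ord0 /= diracE mem_set//=; case.
rewrite big_ord_recl.
transitivity ((lebesgue_measure \x lebesgue_rV n)%E (
    `[a ord0 ord0, b ord0 ord0] `*`
    [set x : 'rV[R]_n | forall i, (\row_j a ord0 (lift ord0 j)) ord0 i <= x ord0 i
                        <= (\row_j b ord0 (lift ord0 j)) ord0 i])).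
  rewrite /= /lebesgueS /pushforward; congr ((_ \x _)%E _).
  apply/seteqP; split=> [[t x] /= h|[t x] /= [h0 h1] i].
    split=> [|i]; first by have := h ord0; rewrite mxE unlift_none in_itv.
    by have := h (lift ord0 i); rewrite !mxE liftK.
  rewrite mxE; case: unliftP => [j|] -> /=; last by move: h0; rewrite in_itv.
  by have := h1 j; rewrite !mxE.
rewrite product_measure1E//=; last first.
  rewrite (_ : [set x : 'rV[R]_n | _] = \bigcap_(i in setT) (fun x : 'rV[R]_n =>
      x ord0 i : measurableTypeR R) @^-1` `[a ord0 (lift ord0 i),
                                            b ord0 (lift ord0 i)]).
    apply: fin_bigcap_measurable => [|i _]; first exact: finite_finset.
    rewrite -[X in measurable X]setTI.
    exact: measurable_coord.
  apply/seteqP; split=> [x h i _|x h i] /=; have := h i; rewrite !mxE ?in_itv//=.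
  by move=> /(_ I); rewrite in_itv.
rewrite lebesgue_measure_itv/= IH; last by move=> i; rewrite !mxE.
rewrite lte_fin EFinM; congr (_ * _)%E.
  case: ltP => // ba; congr EFin; apply/esym/eqP; rewrite subr_eq0.
  by rewrite eq_le ba ab.
by congr EFin; apply: eq_bigr => i _; rewrite !mxE.
Qed.

(* A jet is a family (w_0, w_1, ..., w_m) of square-integrable functions on R^m,
   None indexing w_0 and Some i indexing w_i; a function v in H^1 is represented
   by (v, d_1 v, ..., d_m v). The quotient L2jet by a.e. equality is
   L^2(R^m)^(1+m), whose norm restricted to H^1 is the H^1-norm. *)
Section L2jet.
Context {R : realType} {m : nat}.

Definition jet := option 'I_m -> LfunType (@lebesgue_rV R m) (lee1n 2).

HB.instance Definition _ := GRing.Lmodule.on jet.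

Implicit Types w z : jet.

Definition jdot w z : R :=
  \sum_j (\int[lebesgue_rV m]_x (w j x * z j x))%R.

Definition jnorm w : R := Num.sqrt (jdot w w).

Let jmul_integrable w z j :
  (lebesgue_rV m).-integrable setT (EFin \o (fun x => w j x * z j x)).
Proof. by apply/Lfun1_integrable/Lfun2_mul_Lfun1; exact: LfunP. Qed.

Lemma jdotC w z : jdot w z = jdot z w.
Proof.
by apply: eq_bigr => j _; apply: eq_Rintegral => x _; rewrite mulrC.
Qed.

Lemma jdotDl w w' z : jdot (w + w') z = jdot w z + jdot w' z.
Proof.
rewrite /jdot -big_split; apply: eq_bigr => j _ /=.
rewrite -RintegralD//.
by apply: eq_Rintegral => x _; rewrite -mulrDl.
Qed.

Lemma jdotZl a w z : jdot (a *: w) z = a * jdot w z.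
Proof.
rewrite /jdot mulr_sumr; apply: eq_bigr => j _ /=.
rewrite -RintegralZl//.
by apply: eq_Rintegral => x _; rewrite mulrA.
Qed.

Lemma jdotDr w z z' : jdot w (z + z') = jdot w z + jdot w z'.
Proof. by rewrite jdotC jdotDl !(jdotC w). Qed.

Lemma jdotZr a w z : jdot w (a *: z) = a * jdot w z.
Proof. by rewrite jdotC jdotZl jdotC. Qed.

Lemma jdot_ge0 w : 0 <= jdot w w.
Proof.
apply: sumr_ge0 => j _; apply: Rintegral_ge0 => x _.
by rewrite -expr2 sqr_ge0.
Qed.

Lemma jdot_CauchySchwarz w z : jdot w z ^+ 2 <= jdot w w * jdot z z.
Proof.
have q t : 0 <= jdot w w + 2 * t * jdot w z + t ^+ 2 * jdot z z.
  have := jdot_ge0 (w + t *: z).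
  rewrite !(jdotDl, jdotDr, jdotZl, jdotZr) (jdotC z w); congr (0 <= _).
  by ring.
have [z0|z0] := eqVneq (jdot z z) 0.
  have [->|wz] := eqVneq (jdot w z) 0; first by rewrite expr0n z0 mulr0.
  have := q (- (jdot w w + 1) / (2 * jdot w z)).
  rewrite z0 mulr0 addr0 (_ : 2 * _ * _ = - (jdot w w + 1)); last by field.
  by rewrite opprD addrA subrr add0r ler0N1.
have {z0} z0 : 0 < jdot z z by rewrite lt_neqAle eq_sym z0 jdot_ge0.
have := q (- (jdot w z / jdot z z)).
rewrite (_ : _ + _ = jdot w w - jdot w z ^+ 2 / jdot z z); last first.
  by field; rewrite gt_eqF.
by rewrite subr_ge0 ler_pdivrMr.
Qed.

Lemma jnorm_ge0 w : 0 <= jnorm w.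
Proof. exact: sqrtr_ge0. Qed.

Lemma jnorm_sqr w : jnorm w ^+ 2 = jdot w w.
Proof. by rewrite sqr_sqrtr ?jdot_ge0. Qed.

Lemma ler_jnormD w z : jnorm (w + z) <= jnorm w + jnorm z.
Proof.
rewrite -(@ler_pXn2r _ 2)//; last 2 first.
- by rewrite nnegrE jnorm_ge0.
- by rewrite nnegrE addr_ge0 ?jnorm_ge0.
have h : jdot w z <= jnorm w * jnorm z.
  rewrite /jnorm -sqrtrM ?jdot_ge0// (le_trans (ler_norm _))//.
  by rewrite -sqrtr_sqr ler_wsqrtr// jdot_CauchySchwarz.
rewrite sqrrD !jnorm_sqr !(jdotDl, jdotDr) (jdotC z w).
by lra.
Qed.

Lemma jnormZ a w : jnorm (a *: w) = `|a| * jnorm w.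
Proof.
rewrite /jnorm jdotZl jdotZr mulrA -expr2 sqrtrM ?sqr_ge0//.
by rewrite sqrtr_sqr.
Qed.

Definition jnull : {pred jet} := fun w => jnorm w == 0.

Let jnull_zmod_closed : zmod_closed jnull.
Proof.
split; first by rewrite unfold_in /jnull -(scale0r 0) jnormZ normr0 mul0r.
move=> w z; rewrite !unfold_in /jnull => /eqP w0 /eqP z0.
rewrite eq_le jnorm_ge0 andbT (le_trans (ler_jnormD _ _))// w0 add0r.
by rewrite -scaleN1r jnormZ z0 mulr0.
Qed.

HB.instance Definition _ := GRing.isZmodClosed.Build jet jnull jnull_zmod_closed.

Definition L2jet : Type := {ideal_quot jnull}.

HB.instance Definition _ := GRing.Zmodule.on L2jet.
HB.instance Definition _ := EqQuotient.on L2jet.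

Definition jclass w : L2jet := \pi_L2jet%qT w.
Definition jrepr (u : L2jet) : jet := repr u.

Lemma jreprK : cancel jrepr jclass.
Proof. exact: reprK. Qed.

Lemma jclass_eq w z : jclass w = jclass z <-> jnorm (w - z) = 0.
Proof.
by rewrite /jclass; split=> [/eqP|h]; [|apply/eqP];
  rewrite -Quotient.idealrBE unfold_in; [move/eqP|apply/eqP].
Qed.

Lemma jclassD w z : jclass (w + z) = jclass w + jclass z.
Proof. exact: (@Quotient.pi_add _ jnull w z). Qed.

Lemma jnorm_jrepr w : jnorm (jrepr (jclass w)) = jnorm w.
Proof.
have e : jnorm (jrepr (jclass w) - w) = 0 by apply/jclass_eq/jreprK.
apply/eqP; rewrite eq_le; apply/andP; split.
  by rewrite -[leRHS]add0r -e (le_trans _ (ler_jnormD _ _))// subrK.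
have e' : jnorm (w - jrepr (jclass w)) = 0.
  by rewrite -opprB -scaleN1r jnormZ e mulr0.
by rewrite -[leRHS]add0r -e' (le_trans _ (ler_jnormD _ _))// subrK.
Qed.

Definition jscale a (u : L2jet) : L2jet := jclass (a *: jrepr u).

Let jclass_scale a w : jclass (a *: w) = jscale a (jclass w).
Proof.
apply/jclass_eq; rewrite -scalerBr jnormZ.
have -> : jnorm (w - jrepr (jclass w)) = 0 by apply/jclass_eq; rewrite jreprK.
by rewrite mulr0.
Qed.

Let jscaleA a b u : jscale a (jscale b u) = jscale (a * b) u.
Proof. by rewrite -[u]jreprK -!jclass_scale scalerA. Qed.

Let jscale1 : left_id 1 jscale.
Proof. by move=> u; rewrite -[u]jreprK -jclass_scale scale1r. Qed.

Let jscaleDr : right_distributive jscale +%R.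
Proof.
move=> a u v; rewrite -[u]jreprK -[v]jreprK -!jclass_scale -!jclassD -jclass_scale.
by rewrite scalerDr.
Qed.

Let jscaleDl u : {morph jscale^~ u : a b / a + b}.
Proof. by move=> a b; rewrite -[u]jreprK -!jclass_scale -!jclassD scalerDl. Qed.

HB.instance Definition _ := GRing.Zmodule_isLmodule.Build R L2jet
  jscaleA jscale1 jscaleDr jscaleDl.

Lemma jclassZ a w : jclass (a *: w) = a *: jclass w.
Proof. exact: jclass_scale. Qed.

Definition L2jet_norm (u : L2jet) : R := jnorm (jrepr u).

Let L2jet_normD u v : L2jet_norm (u + v) <= L2jet_norm u + L2jet_norm v.
Proof.
rewrite -[in leLHS](jreprK u) -[in leLHS](jreprK v) -jclassD /L2jet_norm.
by rewrite jnorm_jrepr ler_jnormD.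
Qed.

Let L2jet_normZ a u : L2jet_norm (a *: u) = `|a| * L2jet_norm u.
Proof. by rewrite /L2jet_norm jnorm_jrepr jnormZ. Qed.

Let L2jet_norm0_eq0 u : L2jet_norm u = 0 -> u = 0.
Proof.
move=> u0; rewrite -(jreprK u) -(scale0r (jclass 0)).
by rewrite -jclassZ; apply/jclass_eq; rewrite scale0r subr0.
Qed.

HB.instance Definition _ := Lmodule_isNormed.Build R L2jet
  L2jet_normD L2jet_normZ L2jet_norm0_eq0.

End L2jet.
Arguments jet : clear implicits.
Arguments L2jet : clear implicits.

Section H10.
Context {R : realType} {m : nat}.
Implicit Types (D : set 'rV[R]_m) (phi : 'rV[R]_m -> R) (w : jet R m).

(* Iterated partial derivatives along the list of directions s. *)
Definition partials (s : seq 'I_m) phi : 'rV[R]_m -> R :=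
  foldr (fun i g => 'D_(delta_mx ord0 i) g) phi s.

Definition smooth phi := forall s x, differentiable (partials s phi) x.

Definition test_function D phi :=
  [/\ smooth phi, compact (closure [set x | phi x != 0])
    & closure [set x | phi x != 0] `<=` D].

Definition jet_of phi w :=
  w None =1 phi /\ forall i, w (Some i) =1 partials [:: i] phi.

Definition test_jets D : set (L2jet R m) :=
  [set jclass w | w in [set w | exists2 phi, test_function D phi & jet_of phi w]].

(* H^1_0(D) is the closure of C_c^oo(D) in the H^1-norm. Test functions of D
   vanish outside D, so their H^1-norms over D and over R^m coincide and the
   elements of H^1_0(D) are taken extended by zero to R^m. *)
Definition in_H10 D : {pred L2jet R m} := mem (closure (test_jets D)).

Lemma partials_linear s a f g : smooth f -> smooth g ->
  partials s (a *: f + g) = a *: partials s f + partials s g.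
Proof.
move=> sf sg; elim: s => //= i s ->; apply/funext => x.
have df : derivable (partials s f) x (delta_mx ord0 i) by exact/diff_derivable.
have dg : derivable (partials s g) x (delta_mx ord0 i) by exact/diff_derivable.
by rewrite deriveD ?deriveZ//; exact: derivableZ.
Qed.

Lemma smooth_linear a f g : smooth f -> smooth g -> smooth (a *: f + g).
Proof.
move=> sf sg s x; rewrite partials_linear//.
by apply: differentiableD => //; exact: differentiableZ.
Qed.

Lemma partials0 s : partials s 0 = 0.
Proof.
elim: s => //= i s ->; apply/funext => x.
by rewrite (_ : 0 = cst 0)// derive_cst.
Qed.

Lemma test_function0 D : test_function D 0.
Proof.
have -> : test_function D 0 = [/\ smooth 0, compact (@set0 'rV[R]_m) & set0 `<=` D].
  rewrite /test_function (_ : [set x | _] = set0) ?closure0//.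
  by apply/seteqP; split => x //=; rewrite eqxx.
split => //; last exact: compact0.
by move=> s x; rewrite partials0; exact: differentiable_cst.
Qed.

Lemma test_function_linear D a f g :
  test_function D f -> test_function D g -> test_function D (a *: f + g).
Proof.
move=> [sf cf fD] [sg cg gD].
have h : closure [set x | (a *: f + g) x != 0] `<=`
         closure [set x | f x != 0] `|` closure [set x | g x != 0].
  rewrite -closureU; apply: closure_subset => x /=.
  have [f0|f0] := eqVneq (f x) 0; last by left.
  move=> h; right; apply: contra_neq h => g0.
  by rewrite /= -[LHS]/(a *: f x + g x) f0 g0 scaler0 addr0.
split; first exact: smooth_linear.
- apply: (subclosed_compact _ (compactU cf cg)) => //.
  exact: closed_closure.
- by apply: (subset_trans h) => x [/fD|/gD].
Qed.

Lemma test_jets0 D : test_jets D 0.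
Proof.
exists 0; last by rewrite -(scale0r 0) jclassZ scale0r.
exists 0; first exact: test_function0.
by split=> // i x; rewrite partials0.
Qed.

Lemma test_jets_linear D a u v :
  test_jets D u -> test_jets D v -> test_jets D (a *: u + v).
Proof.
move=> [w [f tf [w0 wi] <-]] [z [g tg [z0 zi] <-]].
exists (a *: w + z); last by rewrite jclassD jclassZ.
exists (a *: f + g); first exact: test_function_linear.
have [[sf _ _] [sg _ _]] := (tf, tg).
split=> [x|i x].
  by rewrite -[LHS]/(a *: w None x + z None x) w0 z0.
rewrite -[LHS]/(a *: w (Some i) x + z (Some i) x) wi zi.
by rewrite partials_linear.
Qed.

Lemma in_H10P D u :
  reflect (forall e, 0 < e -> exists2 v, test_jets D v & `|u - v| < e)
          (u \in in_H10 D).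
Proof.
apply: (iffP idP); rewrite inE.
  move=> cu e e0; have [v [tv]] := cu _ (nbhsx_ballx u e e0).
  by rewrite -ball_normE; exists v.
move=> h B /nbhs_ballP[e /= e0 eB]; have [v tv uv] := h _ e0.
by exists v; split=> //; apply: eB; rewrite -ball_normE.
Qed.

Lemma in_H10_submod_closed D : submod_closed (in_H10 D).
Proof.
split.
  by apply/in_H10P => e e0; exists 0; [exact: test_jets0|rewrite subrr normr0].
move=> a u v /in_H10P hu /in_H10P hv; apply/in_H10P => e e0.
have a0 : 0 < `|a| + 1 by rewrite ltr_wpDl.
have [u' tu uu'] := hu (e / 2 / (`|a| + 1)) ltac:(by rewrite !divr_gt0).
have [v' tv vv'] := hv (e / 2) ltac:(by rewrite divr_gt0).
exists (a *: u' + v'); first exact: test_jets_linear.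
rewrite opprD addrACA -scalerBr (le_lt_trans (ler_normD _ _))//.
rewrite [ltRHS](splitr e) ler_ltD// normrZ.
move: uu'; rewrite ltr_pdivlMr// => /ltW; apply: le_trans.
by rewrite mulrC ler_wpM2l// lerDl.
Qed.

HB.instance Definition _ D :=
  GRing.isSubmodClosed.Build R (L2jet R m) (in_H10 D) (in_H10_submod_closed D).

Record H10 D : Type := MkH10 { H10_jet :> L2jet R m ; _ : H10_jet \in in_H10 D }.

HB.instance Definition _ D := [isSub for @H10_jet D].
HB.instance Definition _ D := [Choice of H10 D by <:].
HB.instance Definition _ D := [SubChoice_isSubLmodule of H10 D by <:].

Section norm.
Variable D : set 'rV[R]_m.

Definition H10_norm (u : H10 D) : R := `|H10_jet u|.

Let H10_normD u v : H10_norm (u + v) <= H10_norm u + H10_norm v.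
Proof. exact: ler_normD. Qed.

Let H10_normZ a u : H10_norm (a *: u) = `|a| * H10_norm u.
Proof. exact: normrZ. Qed.

Let H10_norm0_eq0 u : H10_norm u = 0 -> u = 0.
Proof. by move=> /normr0_eq0 u0; exact: val_inj. Qed.

HB.instance Definition _ := Lmodule_isNormed.Build R (H10 D)
  H10_normD H10_normZ H10_norm0_eq0.

End norm.

End H10.

Definition is_domain (R : realType) m (D : set 'rV[R]_m) :=
  [/\ D !=set0, open D & connected D].

(* c matters only on D; it is extended by zero to use Lfun on R^m. *)
Definition Linfty (R : realType) m (D : set 'rV[R]_m) (c : 'rV[R]_m -> R) :=
  (c \_ D) \in Lfun (lebesgue_rV m) +oo%E.

Section diffusion.
Context {R : realType} {m : nat} {D : set 'rV[R]_m}.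
Implicit Types u v : H10 D.

Definition grad u (x : 'rV[R]_m) : 'rV[R]_m :=
  \row_i jrepr (H10_jet u) (Some i) x.

(* diffusion c u v = <A u, v> for the operator A : V -> V' with coefficient c. *)
Definition diffusion (c : 'rV[R]_m -> R) u v : R :=
  (\int[lebesgue_rV m]_(x in D)
     (c x * \sum_i grad u x ord0 i * grad v x ord0 i))%R.

End diffusion.

Definition cube (R : realType) d : set 'rV[R]_d :=
  [set y | forall i, -1 <= y ord0 i <= 1].

Definition affine_coef (R : realType) m d (abar : 'rV[R]_m -> R)
    (psi : 'I_d -> 'rV[R]_m -> R) (y : 'rV[R]_d) (x : 'rV[R]_m) : R :=
  abar x - \sum_i y ord0 i * psi i x.

Section taylor.
Context {R : realType} {d : nat} {V : normedModType R}.
Implicit Types (u : 'rV[R]_d -> V) (nu : 'I_d -> nat).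

Definition partial_pow (i : 'I_d) n u : 'rV[R]_d -> V :=
  iter n (fun w => 'D_(delta_mx ord0 i) w) u.

Definition partial_nu nu u : 'rV[R]_d -> V :=
  foldr (fun i => partial_pow i (nu i)) u (enum 'I_d).

Definition taylor_coef u nu : V :=
  ((\prod_i (nu i)`!)%:R)^-1 *: partial_nu nu u 0.

Definition taylor_trunc u k (y : 'rV[R]_d) : V :=
  \sum_(nu : {ffun 'I_d -> 'I_k.+1} | (\sum_i nu i <= k)%N)
    (\prod_i y ord0 i ^+ nu i) *: taylor_coef u (fun i => nu i).

End taylor.

Section rank.
Context {R : realType} {d : nat} {V : normedModType R}.
Variable mu : probability 'rV[R]_d R.
Implicit Types (g w : 'rV[R]_d -> V) (phi : 'rV[R]_d -> R).

(* z is approximated by integrals of simple functions s with int |g - s| -> 0. *)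
Definition is_bochner_integral g (z : V) := forall e : R, 0 < e ->
  exists n (A : 'I_n -> set 'rV[R]_d) (c : 'I_n -> V),
    let s y := \sum_i \1_(A i) y *: c i in
    [/\ forall i, measurable (A i),
        measurable_fun setT (fun y => `|g y - s y|),
        (\int[mu]_y (`|g y - s y|)%:E < e%:E)%E
      & `|z - \sum_i fine (mu (A i)) *: c i| < e].

Definition bochner_integral g : V := get (is_bochner_integral g).

(* The measure mu is meant to be carried by the cube U, so that integrals over U
   are integrals over the whole space. *)
Definition Mop w phi : V := bochner_integral (fun y => phi y *: w y).

Definition lin_indep n (v : 'I_n -> V) :=
  forall c : 'I_n -> R, \sum_i c i *: v i = 0 -> forall i, c i = 0.

(* Linear dimension, +oo allowed. *)
Definition dimension (S : set V) : \bar R :=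
  ereal_sup [set n%:R%:E | n in
    [set n | exists v : 'I_n -> V, (forall i, S (v i)) /\ lin_indep v]].

Definition rank w : \bar R :=
  dimension [set Mop w phi | phi in [set phi | phi \in Lfun mu 2%:E]].

End rank.

Definition ncoef d k : nat := 'C(k + d, d).

(* Main.v *)
(* Let O be the open cube. Coercivity of B_y = A - sum_i y_i A_i on H^1_0 (from
   ellipticity and Poincare's inequality) together with completeness of H^1_0
   makes difference quotients of solutions of B_y w = g(y) Cauchy, so all iterated
   partials w_s of u (s a list of directions) exist on O and solve
     B_y w_s = [s = nil] f + sum_i (number of i in s) A_i w_(s minus one i).
   In particular w_s depends only on the multiset underlying s. If
   sum_i A_i = theta A, then at y = 0 an induction on s gives Euler's identity
     sum_i w_(i :: s)(0) = theta (|s| + 1) w_s(0),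
   so every partial of order at most k at 0 is a combination of those of order
   exactly k, and there are n(d - 1, k) multi-indices of size k. *)

Require Import Defs.
From HB Require Import structures.
From mathcomp Require Import all_boot all_order all_algebra.
From mathcomp Require Import all_classical all_reals all_analysis.
From mathcomp Require Import measurable_realfun ess_sup_inf.
From mathcomp Require mpoly.
From mathcomp Require Import ring lra zify.
Import (canonicals) mpoly.

Set Implicit Arguments.
Unset Strict Implicit.
Unset Printing Implicit Defensive.

Import Order.TTheory GRing.Theory Num.Theory.
Import numFieldNormedType.Exports.

Local Open Scope classical_set_scope.
Local Open Scope ring_scope.

(** * Bounded bilinear forms *)

(** At y = theta^-1 (1, ..., 1) the operator A - sum_i y_i A_i vanishes. It is therefore linear in
    the distance to that point, and this is the origin of the factor theta (|s| + 1). Since [u] is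
    given as a solution, no operator has to be inverted: uniqueness and an a priori bound, both read
    off coercivity, suffice, and this part runs for abstract forms [a], [b i] on a complete normed
    space. Nothing is known beforehand about the regularity of [u], so derivability, equation and
    symmetry of the partials go through one joint induction. For the rank, a formula in a finite
    span is not yet enough: [Mop] is defined by limits of integrals of simple functions whose values
    may lie outside the span. Orthogonal projection for the H^1 inner product brings the limits back
    into it. *)

Lemma cvg_cauchy_bound (R : realType) (V : completeNormedModType R) (T : Type)
    (F : set_system T) (PF : ProperFilter F) (Q : T -> V) (z : T -> R) (A : set T) :
    F A -> (forall h h', A h -> A h' -> `|Q h - Q h'| <= z h + z h') ->
  z @ F --> (0 : R) -> cvg (Q @ F).
Proof.
move=> FA hQ hz; apply: cauchy_cvg; apply: cauchy_exP => e e0.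
have e20 : 0 < e / 2 by rewrite divr_gt0.
have Fz : F [set h | `|z h| < e / 2] by exact: (@cvgr0_norm_lt _ _ _ _ _ z).
have [h0 [Ah0 zh0]] := filter_ex (filterI FA Fz).
exists (Q h0); rewrite /fmap /=.
apply: filterS (filterI FA Fz) => h [Ah zh].
rewrite -ball_normE /= (le_lt_trans (hQ _ _ Ah0 Ah))// [ltRHS]splitr.
by rewrite ltrD// (le_lt_trans (ler_norm _)).
Qed.

(** Linearity is asked in the first argument only: the second one holds a fixed test vector, of
    which the estimates see just the norm. *)
Record bounded_bilinear (R : realType) (V : normedModType R) (b : V -> V -> R) :=
  BoundedBilinear {
    bilinear_left : forall (t : R) w w' v, b (t *: w + w') v = t * b w v + b w' v ;
    bilinear_bounded : exists2 M : R, 0 <= M &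
      forall w v, `|b w v| <= M * `|w| * `|v| }.

Section bounded_bilinear_theory.
Context (R : realType) (V : normedModType R) (b : V -> V -> R).
Hypothesis bb : bounded_bilinear b.

Lemma bilinearD w w' v : b (w + w') v = b w v + b w' v.
Proof. by rewrite -[w]scale1r (bilinear_left bb) scale1r mul1r. Qed.

Lemma bilinear0 v : b 0 v = 0.
Proof. by apply: (addrI (b 0 v)); rewrite -bilinearD !addr0. Qed.

Lemma bilinearZ t w v : b (t *: w) v = t * b w v.
Proof. by rewrite -[X in b X]addr0 (bilinear_left bb) bilinear0 addr0. Qed.

Lemma bilinearB w w' v : b (w - w') v = b w v - b w' v.
Proof. by rewrite addrC -scaleN1r (bilinear_left bb) mulN1r addrC. Qed.

Lemma bilinear_sum (I : Type) (r : seq I) (P : pred I) (F : I -> V) v :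
  b (\sum_(i <- r | P i) F i) v = \sum_(i <- r | P i) b (F i) v.
Proof.
by elim/big_rec2: _ => [|i x y _ <-]; [exact: bilinear0|exact: bilinearD].
Qed.

Lemma bilinear_cvg (T : Type) (F : set_system T) (FF : Filter F) (Q : T -> V)
    (q v : V) : Q @ F --> q -> (fun h => b (Q h) v) @ F --> b q v.
Proof.
have [M M0 hM] := bilinear_bounded bb.
move=> Qq; apply: (iffLR (subr_cvg0 _ _)); apply: norm_cvg0.
have hz : (fun h => M * `|Q h - q| * `|v|) @ F --> 0.
  rewrite -(mul0r `|v|) -(mulr0 M); apply: cvgMr_tmp; apply: cvgMl_tmp.
  exact: (iffRL (norm_cvg0P _) (iffRL (subr_cvg0 _ _) Qq)).
refine (squeeze_cvgr _ (cvg_cst (0 : R)) hz); apply: nearW => h.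
by rewrite normr_ge0 -bilinearB hM.
Qed.

End bounded_bilinear_theory.

Lemma bounded_bilinear_family (R : realType) (V : normedModType R) d
    (b : 'I_d -> V -> V -> R) : (forall i, bounded_bilinear (b i)) ->
  exists2 M, 0 <= M & forall i w v, `|b i w v| <= M * `|w| * `|v|.
Proof.
move=> bb; have /choice[M hM] : forall i, exists M, 0 <= M /\
    forall w v, `|b i w v| <= M * `|w| * `|v|.
  by move=> i; have [M M0 hM] := bilinear_bounded (bb i); exists M.
have M0 i : 0 <= M i by case: (hM i).
exists (\sum_i M i); first exact: sumr_ge0.
move=> i w v; have [_ /(_ w v) h] := hM i; apply: (le_trans h).
by rewrite -!mulrA ler_wpM2r ?mulr_ge0// (bigD1 i)//= lerDl sumr_ge0.
Qed.

Lemma bounded_bilinear_pencil (R : realType) (V : normedModType R) d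
    (a : V -> V -> R) (b : 'I_d -> V -> V -> R) (t : 'I_d -> R) :
  bounded_bilinear a -> (forall i, bounded_bilinear (b i)) ->
  bounded_bilinear (fun w v => a w v - \sum_i t i * b i w v).
Proof.
move=> ba bb; split=> [r w w' v|].
  rewrite (bilinear_left ba); under eq_bigr do rewrite (bilinear_left (bb _)).
  rewrite mulrBr mulr_sumr; under eq_bigr do rewrite mulrDr mulrCA.
  by rewrite big_split /=; ring.
have [Ma Ma0 hMa] := bilinear_bounded ba.
have [M M0 hM] := bounded_bilinear_family bb.
exists (Ma + (\sum_i `|t i|) * M).
  by rewrite addr_ge0// mulr_ge0// sumr_ge0.
move=> w v; rewrite (le_trans (ler_normB _ _))// !mulrDl lerD// !mulr_suml.
rewrite (le_trans (ler_norm_sum _ _ _))// ler_sum// => i _.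
by rewrite normrM -!mulrA ler_wpM2l// mulrA.
Qed.

(** * Parametric variational equations *)

(** The equation for [u] is known on [cube] only; on the open cube small coordinate shifts stay
    inside, so it can be differentiated. *)
Definition open_cube (R : realType) d : set 'rV[R]_d :=
  [set y | forall i, `|y ord0 i| < 1].

Lemma open_cube_cube (R : realType) d : @open_cube R d `<=` @cube R d.
Proof. by move=> y hy i; rewrite -ler_norml ltW. Qed.

Lemma near_open_cube (R : realType) d (y : 'rV[R]_d) j : open_cube y ->
  \forall h \near (0 : R)^', h != 0 /\ open_cube (h *: delta_mx ord0 j + y).
Proof.
move=> hy; have e0 : 0 < 1 - `|y ord0 j| by rewrite subr_gt0.
near=> h; split; first by near: h; exact: nbhs_dnbhs_neq.
move=> i; rewrite !mxE eqxx /=; have [->|ij] := eqVneq i j.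
  rewrite mulr1 (le_lt_trans (ler_normD _ _))// -ltrBrDr.
  by near: h; exact: dnbhs0_lt.
by rewrite mulr0 add0r.
Unshelve. all: by end_near. Qed.

Section pencil.
Context (R : realType) (V : completeNormedModType R) (d : nat).
Variables (a : V -> V -> R) (b : 'I_d -> V -> V -> R) (c : R).
Hypotheses (ba : bounded_bilinear a) (bb : forall i, bounded_bilinear (b i)).
Let B (y : 'rV[R]_d) w v := a w v - \sum_i y ord0 i * b i w v.
Hypotheses (c0 : 0 < c)
  (coer : forall y, cube y -> forall w, c * `|w| ^+ 2 <= B y w w).

Let bB y : bounded_bilinear (B y).
Proof. exact: (bounded_bilinear_pencil (fun i => y ord0 i)). Qed.

(** The a priori estimate of Lax and Milgram: test with [v := w] and divide by [|w|]. Coercivity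
    enters the calculus of derivatives only through it. *)
Lemma pencil_le y w K : cube y -> 0 <= K -> (forall v, `|B y w v| <= K * `|v|) ->
  `|w| <= K / c.
Proof.
move=> hy K0 hw; have [->|w0] := eqVneq w 0.
  by rewrite normr0 divr_ge0// ltW.
have w1 : 0 < `|w| by rewrite normr_gt0.
rewrite ler_pdivlMr// mulrC -(ler_pM2r w1) -mulrA -expr2.
by rewrite (le_trans (coer hy w))// (le_trans (ler_norm _)).
Qed.

Lemma pencil_inj y w w' : cube y -> (forall v, B y w v = B y w' v) -> w = w'.
Proof.
move=> hy hw; apply/eqP; rewrite -subr_eq0 -normr_eq0 eq_le normr_ge0 andbT.
rewrite -(mul0r c^-1); apply: (pencil_le hy) => // v.
by rewrite (bilinearB (bB y)) hw subrr normr0 mul0r.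
Qed.

Lemma pencil_shift h y j w v :
  B (h *: delta_mx ord0 j + y) w v = B y w v - h * b j w v.
Proof.
rewrite /B; under eq_bigr do rewrite !mxE eqxx /= mulrDl.
rewrite big_split /= (bigD1 j)//= big1 ?eqxx; last first.
  by move=> i ij; rewrite (negbTE ij) mulr0 mul0r.
by rewrite mulr1 addr0; ring.
Qed.

(* With q the difference quotient of w, B_y q and B_(y + h e) q are explicit; the
   latter bounds q, the former makes it Cauchy as h -> 0. *)
Lemma pencil_derivable (w : 'rV[R]_d -> V) (g : 'I_d -> 'rV[R]_d -> V)
    (k : 'I_d -> R) (F : V -> R) (y : 'rV[R]_d) (j : 'I_d) :
  let e := delta_mx ord0 j in
  (forall y, open_cube y -> forall v, B y (w y) v = F v + \sum_i k i * b i (g i y) v) ->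
  open_cube y -> (forall i, derivable (g i) y e) ->
  derivable w y e /\ forall v,
    B y ('D_e w y) v = \sum_i k i * b i ('D_e (g i) y) v + b j (w y) v.
Proof.
move=> e hw hy dg.
pose dq (f : 'rV[R]_d -> V) (h : R) : V := h^-1 *: ((f \o shift y) (h *: e) - f y).
pose A := [set h : R | h != 0 /\ open_cube (h *: e + y)].
have nA : \forall h \near (0 : R)^', A h by exact: near_open_cube.
have [M M0 hM] := bounded_bilinear_family bb.
(* Subtract the equations at [h *: e + y] and [y]; the change of operator between these points
   leaves the term in [b j]. Moving the operator back to [y] turns [w y] into [w (h *: e + y)]
   there, which is [E2]. *)
have E1 h v : A h ->
    B (h *: e + y) (dq w h) v = b j (w y) v + \sum_i k i * b i (dq (g i) h) v.
  move=> [h0 hh]; rewrite (bilinearZ (bB _)) (bilinearB (bB _)) /= hw//.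
  rewrite pencil_shift hw//.
  under [in RHS]eq_bigr do
    rewrite (bilinearZ (bb _)) (bilinearB (bb _)) mulrCA mulrBr.
  by rewrite -mulr_sumr sumrB /=; field.
have E2 h v : A h ->
    B y (dq w h) v = b j (w (h *: e + y)) v + \sum_i k i * b i (dq (g i) h) v.
  move=> Ah; have := E1 _ v Ah; rewrite pencil_shift => /eqP.
  rewrite subr_eq => /eqP ->; rewrite (bilinearZ (bb _)) (bilinearB (bb _)) /=.
  by case: Ah => h0 _; field.
have dgl i : dq (g i) h @[h --> 0^'] --> 'D_e (g i) y by exact: dg.
pose G h := \sum_i `|k i| * `|dq (g i) h|.
have Gl : G h @[h --> 0^'] --> \sum_i `|k i| * `|'D_e (g i) y|.
  apply: cvg_big => [|i _]; first exact: add_continuous.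
  by apply: cvgMl_tmp; exact: cvg_norm.
have ksum (q : 'I_d -> V) v :
    `|\sum_i k i * b i (q i) v| <= M * (\sum_i `|k i| * `|q i|) * `|v|.
  rewrite (le_trans (ler_norm_sum _ _ _))// mulr_sumr mulr_suml ler_sum// => i _.
  by rewrite normrM (mulrCA M) -mulrA ler_wpM2l// -mulrA mulrA.
have G0 h : 0 <= G h by apply: sumr_ge0 => i _; rewrite mulr_ge0.
have bound h : A h -> `|dq w h| <= M * (`|w y| + G h) / c.
  move=> Ah; have [_ /open_cube_cube hh] := Ah.
  apply: (pencil_le hh) => [|v]; first by rewrite mulr_ge0// addr_ge0.
  rewrite E1// (le_trans (ler_normD _ _))// mulrDr mulrDl.
  by rewrite lerD// ksum.
(* Continuity of [w] in direction [e]: the increment is [h] times a quotient that [bound] keeps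
   bounded. *)
have wl : `|w (h *: e + y) - w y| @[h --> 0^'] --> (0 : R).
  have z0 : `|h| * (M * (`|w y| + G h) / c) @[h --> 0^'] --> (0 : R).
    rewrite -[X in _ --> X](mul0r (M * (`|w y| + \sum_i `|k i| * `|'D_e (g i) y|) / c)).
    apply: cvgM; first by apply: (iffRL (norm_cvg0P _)); exact: nbhs_dnbhs.
    by apply: cvgMr_tmp; apply: cvgMl_tmp; apply: cvgD => //; exact: cvg_cst.
  refine (squeeze_cvgr _ (cvg_cst (0 : R)) z0).
  near=> h; have Ah : A h by near: h.
  rewrite normr_ge0 /= -[X in `|X|](scalerKV (proj1 Ah)) normrZ ler_wpM2l//.
  exact: bound.
(* Subtract [E2] at [h] and [h'], apply [pencil_le], and insert the limits [w y] and ['D_e (g i) y]: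
   the bound splits into [z h + z h']. *)
pose z (h : R) : R := M / c * (`|w (h *: e + y) - w y| +
                     \sum_i `|k i| * `|dq (g i) h - 'D_e (g i) y|).
have zl : z h @[h --> 0^'] --> (0 : R).
  have sl : (\sum_i `|k i| * `|dq (g i) h - 'D_e (g i) y|) @[h --> 0^'] -->
      \sum_(i < d) `|k i| * 0.
    apply: cvg_big => [|i _]; first exact: add_continuous.
    by apply: cvgMl_tmp; exact: (iffRL (norm_cvg0P _) (iffRL (subr_cvg0 _ _) (dgl i))).
  have E0 : M / c * (0 + \sum_(i < d) `|k i| * 0) = 0.
    by rewrite big1 ?addr0 ?mulr0// => i _; rewrite mulr0.
  have h1 : (`|w (h *: e + y) - w y| + \sum_i `|k i| * `|dq (g i) h - 'D_e (g i) y|)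
      @[h --> 0^'] --> 0 + \sum_(i < d) `|k i| * 0 by exact: cvgD.
  have : z h @[h --> 0^'] --> M / c * (0 + \sum_(i < d) `|k i| * 0).
    by apply: cvgMl_tmp; exact: h1.
  by rewrite E0.
have dw : derivable w y e.
  have PF : ProperFilter (0 : R)^' by exact: _.
  apply: (@cvg_cauchy_bound R V R _ PF _ z A nA _ zl) => h h' Ah Ah'.
  rewrite -mulrDr mulrAC.
  apply: (pencil_le (open_cube_cube hy)) => [|v].
    by rewrite mulr_ge0// !addr_ge0// sumr_ge0// => i _; rewrite mulr_ge0.
  rewrite -!/(dq _ _) (bilinearB (bB _)) !E2// opprD addrACA -(bilinearB (bb _)).
  rewrite -sumrB; under eq_bigr do rewrite -mulrBr -(bilinearB (bb _)).
  rewrite addrACA mulrDr mulrDl (le_trans (ler_normD _ _))// lerD//.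
    rewrite (le_trans (hM _ _ _))// ler_wpM2r// ler_wpM2l//.
    rewrite (_ : _ - _ = (w (h *: e + y) - w y) - (w (h' *: e + y) - w y)).
      exact: ler_normB.
    by rewrite opprB addrA subrK.
  rewrite (le_trans (ksum _ _))// ler_wpM2r// ler_wpM2l// -big_split /= ler_sum// => i _.
  rewrite -mulrDr ler_wpM2l//.
  rewrite (_ : _ - _ = (dq (g i) h - 'D_e (g i) y) - (dq (g i) h' - 'D_e (g i) y)).
    exact: ler_normB.
  by rewrite opprB addrA subrK.
split=> // v.
have l1 : B y (dq w h) v @[h --> 0^'] --> B y ('D_e w y) v.
  exact: (bilinear_cvg (bB y)).
have l2 : b j (w (h *: e + y)) v + \sum_i k i * b i (dq (g i) h) v @[h --> 0^'] -->
    b j (w y) v + \sum_i k i * b i ('D_e (g i) y) v.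
  apply: cvgD.
    by apply: (bilinear_cvg (bb j)); exact: (iffLR (subr_cvg0 _ _) (iffLR (norm_cvg0P _) wl)).
  apply: cvg_big => [|i _]; first exact: add_continuous.
  by apply: cvgMl_tmp; exact: (bilinear_cvg (bb i)).
rewrite addrC; apply: (cvg_unique _ l1) => //.
apply: cvg_trans l2; apply: near_eq_cvg; near=> h.
by rewrite E2//; near: h.
Unshelve. all: by end_near. Qed.
End pencil.

(** * Iterated partials and Euler's identity *)

Definition iter_partial (R : realType) (V : normedModType R) d (u : 'rV[R]_d -> V)
    (s : seq 'I_d) : 'rV[R]_d -> V :=
  foldr (fun i g => 'D_(delta_mx ord0 i) g) u s.

Section parametric_solution.
Context (R : realType) (V : completeNormedModType R) (d : nat).
Variables (a : V -> V -> R) (b : 'I_d -> V -> V -> R) (c : R).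
Hypotheses (ba : bounded_bilinear a) (bb : forall i, bounded_bilinear (b i)).
Let B (y : 'rV[R]_d) w v := a w v - \sum_i y ord0 i * b i w v.
Hypotheses (c0 : 0 < c)
  (coer : forall y, cube y -> forall w, c * `|w| ^+ 2 <= B y w w).
Variables (f : V -> R) (u : 'rV[R]_d -> V).
Hypothesis hu : forall y, cube y -> forall v, B y (u y) v = f v.
Let W := iter_partial u.

(** The claims depend on each other. The equation for [j :: t] is the derivative of that for [t],
    but bringing it into the form with [rem] needs permutation invariance of shorter lists;
    invariance follows from the equation, whose right-hand side sees only the multiset, by
    uniqueness. The third clause keeps the derivative in raw form, ready to be summed over [j]. *)
Lemma iter_partial_weak s :
  [/\ forall y, open_cube y -> forall v, B y (W s y) v =
        (s == [::])%:R * f v + \sum_i (count_mem i s)%:R * b i (W (rem i s) y) v,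
      forall t, perm_eq s t -> forall y, open_cube y -> W s y = W t y &
      forall j y, open_cube y -> forall v, B y (W (j :: s) y) v =
        \sum_i (count_mem i s)%:R * b i (W (j :: rem i s) y) v + b j (W s y) v].
Proof.
pose S s := [/\ forall y, open_cube y -> forall v, B y (W s y) v =
        (s == [::])%:R * f v + \sum_i (count_mem i s)%:R * b i (W (rem i s) y) v,
      forall t, perm_eq s t -> forall y, open_cube y -> W s y = W t y,
      forall j y, open_cube y -> derivable (W s) y (delta_mx ord0 j) &
      forall j y, open_cube y -> forall v, B y (W (j :: s) y) v =
        \sum_i (count_mem i s)%:R * b i (W (j :: rem i s) y) v + b j (W s y) v].
suff : S s by case.
have [n ns] := ubnP (size s); elim: n s ns => // n IH s.
rewrite ltnS leq_eqVlt => /orP[/eqP sn|/IH//].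
have E t : size t = n -> forall y, open_cube y -> forall v, B y (W t y) v =
    (t == [::])%:R * f v + \sum_i (count_mem i t)%:R * b i (W (rem i t) y) v.
  case: t => [_|j t tn] y hy v.
    rewrite mul1r big1 ?addr0; last by move=> i _; rewrite mul0r.
    by apply: hu; exact: open_cube_cube.
  have [_ P _ ->//] : S t by apply: IH; rewrite -tn.
  have cE i : count_mem i (j :: t) = ((j == i) + count_mem i t)%N by [].
  have rE i : rem i (j :: t) = if j == i then t else j :: rem i t by [].
  rewrite mul0r add0r (bigD1 j)// [RHS](bigD1 j)// cE rE eqxx natrD mulrDl mul1r.
  (* Differentiation produces [j :: rem j t] where the claim has [t]: a permutation of it if [j]
     occurs in [t], and otherwise the coefficient is zero. *)
  have -> : (count_mem j t)%:R * b j (W (j :: rem j t) y) v =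
      (count_mem j t)%:R * b j (W t y) v.
    have [jt|/count_memPn->] := boolP (j \in t); last by rewrite !mul0r.
    by rewrite (P (j :: rem j t))//; exact: perm_to_rem.
  rewrite addrAC [in LHS](addrC (_ * _)); congr (_ + _).
  by apply: eq_bigr => i ij; rewrite cE rE eq_sym (negbTE ij) add0n.
have P t : perm_eq s t -> forall y, open_cube y -> W s y = W t y.
  move=> st y hy; apply: (pencil_inj ba bb c0 coer (open_cube_cube hy)) => v.
  rewrite -!/(B _ _ _) !E//; last by rewrite -(perm_size st).
  congr (_ * _ + _); first by rewrite -!size_eq0 (perm_size st).
  apply: eq_bigr => i _; rewrite -(permP st).
  have [si|/count_memPn->] := boolP (i \in s); last by rewrite !mul0r.
  have [_ Pr _ _] : S (rem i s).
    by apply: IH; rewrite size_rem// sn prednK// -sn; case: (s) si.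
  rewrite (Pr (rem i t))// -(perm_cons i) -(permPl (perm_to_rem si)) (permPl st).
  by rewrite perm_to_rem// -(perm_mem st).
(* For [i] not in [s], [rem i s] is [s] itself, whose derivability is being proved. The coefficient
   of that term is zero, so a constant replaces it and avoids the circle. *)
pose g i := if i \in s then W (rem i s) else cst 0.
have Dg i j y : open_cube y -> derivable (g i) y (delta_mx ord0 j).
  move=> hy; rewrite /g; case: ifPn => [si|_]; last exact: derivable_cst.
  have [_ _ D _] : S (rem i s); last exact: D.
  by apply: IH; rewrite size_rem// sn prednK// -sn; case: (s) si.
have main j y : open_cube y -> derivable (W s) y (delta_mx ord0 j) /\
    forall v, B y (W (j :: s) y) v =
      \sum_i (count_mem i s)%:R * b i (W (j :: rem i s) y) v + b j (W s y) v.
  move=> hy; have [|D h] := pencil_derivable (w := W s) (g := g) (j := j)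
      (k := fun i => (count_mem i s)%:R) (F := fun v => (s == [::])%:R * f v)
      ba bb c0 coer _ hy (fun i => Dg i j y hy).
    move=> z hz v; rewrite -/(B _ _ _) E//; congr (_ + _); apply: eq_bigr => i _.
    rewrite /g; case: ifPn => // /count_memPn ->.
    by rewrite !mul0r.
  split=> // v; rewrite -[W (j :: s)]/('D_(delta_mx ord0 j) (W s)) /B h.
  congr (_ + _); apply: eq_bigr => i _; rewrite /g.
  by case: ifPn => // /count_memPn ->; rewrite !mul0r.
by split=> [|||j y hy]; [exact: E|exact: P|move=> j y /(main j y)[]|case: (main j y)].
Qed.

Lemma open_cube0 : open_cube (0 : 'rV[R]_d).
Proof. by move=> i; rewrite mxE normr0. Qed.

Variable theta : R.
Hypothesis hsum : forall w v, \sum_i b i w v = theta * a w v.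

(* Euler's identity for u, homogeneous of degree -1 about theta^-1 (1, ..., 1),
   differentiated along s at the origin. *)
Lemma iter_partial_euler s :
  \sum_i W (i :: s) 0 = (theta * (size s).+1%:R) *: W s 0.
Proof.
have B0 w v : B 0 w v = a w v.
  by rewrite /B big1 ?subr0// => i _; rewrite mxE mul0r.
have O0 := open_cube0.
have [n ns] := ubnP (size s); elim: n s ns => // n IH s.
rewrite ltnS => sn.
apply: (pencil_inj ba bb c0 coer (open_cube_cube O0)) => v.
rewrite -!/(B _ _ _) !B0 (bilinear_sum ba) (bilinearZ ba).
have [E _ D] := iter_partial_weak s.
under eq_bigr do rewrite -B0 D//.
rewrite big_split /= hsum exchange_big /=.
under eq_bigr do rewrite -mulr_sumr -(bilinear_sum (bb _)).
(* [rem i s] is one shorter than [s], so by induction the inner sum is theta |s| times the partial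
   along [rem i s]; the equation for [s] then adds these up. The missing theta is the term already
   given by [hsum]. *)
have -> : \sum_i (count_mem i s)%:R * b i (\sum_j W (j :: rem i s) 0) v =
    theta * (size s)%:R * a (W s 0) v.
  case: s sn E {D} => [|k s] sn E.
    by rewrite mulr0 mul0r big1// => i _; rewrite mul0r.
  rewrite -B0 E// mul0r add0r mulr_sumr; apply: eq_bigr => i _.
  have [si|/count_memPn->] := boolP (i \in k :: s); last by rewrite !mul0r mulr0.
  rewrite IH ?size_rem//= -?(ltnS s)//.
  by rewrite (bilinearZ (bb _)) mulrCA.
by rewrite -[in RHS]natr1 mulrDr mulr1 [in RHS]mulrDl.
Qed.

End parametric_solution.

(** * Completeness *)

Section L2_complete.
Context d (T : measurableType d) (R : realType) (mu : {measure set T -> \bar R}).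

Lemma Lnorm2_lty (f : T -> R) :
  ('N[mu]_2[EFin \o f] < +oo)%E = (\int[mu]_x (f x ^+ 2)%:E < +oo)%E.
Proof.
have I0 : (0 <= \int[mu]_x (f x ^+ 2)%:E)%E.
  by apply: integral_ge0 => x _; rewrite lee_fin sqr_ge0.
rewrite unlock (_ : \int[mu]_x _ = \int[mu]_x (f x ^+ 2)%:E)%E; last first.
  apply: eq_integral => x _ /=.
  by rewrite powR_mulrn ?normr_ge0// real_normK ?num_real.
by apply/idP/idP => [/lty_poweRy|/poweR_lty]; apply; rewrite invr_neq0.
Qed.

Lemma Lfun2P (f : T -> R) : (f \in Lfun mu 2) <->
  measurable_fun setT f /\ (\int[mu]_x (f x ^+ 2)%:E < +oo)%E.
Proof.
by split=> [/andP[/[!inE] mf] | [mf h]]; [|apply/andP; rewrite !inE; split=> //];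
   rewrite /finite_norm/= ?Lnorm2_lty.
Qed.

(** The Riesz-Fischer theorem for fast Cauchy sequences. The rate 8^-n of the squares leaves room
    for the weight 4^n, since 4^n 8^-n = 2^-n is still summable. *)
Lemma L2_complete (f : nat -> T -> R) : (forall n, f n \in Lfun mu 2) ->
  (forall n p, (n <= p)%N ->
     (\int[mu]_x ((f n x - f p x) ^+ 2)%:E <= ((8%:R ^- n : R)%:E))%E) ->
  exists2 g, g \in Lfun mu 2 &
    forall n, (\int[mu]_x ((f n x - g x) ^+ 2)%:E <= ((8%:R ^- n : R)%:E))%E.
Proof.
move=> f2 hf; have mf n : measurable_fun setT (f n) by case/Lfun2P : (f2 n).
have mdiff n p : measurable_fun setT (fun x : T => ((f n x - f p x) ^+ 2)%:E : \bar R).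
  apply/measurable_EFinP; apply: measurable_funX; exact: measurable_funB.
(* Finiteness of sum_n 4^n |f_n - f_(n+1)|^2 at x forces |f_n - f_(n+1)| = O(2^-n). *)
pose D n x : \bar R := ((4 ^+ n)%:E * ((f n x - f n.+1 x) ^+ 2)%:E)%E.
have D0 n x : (0 <= D n x)%E.
  by apply: mule_ge0; rewrite lee_fin; [exact: exprn_ge0|exact: sqr_ge0].
have mD n : measurable_fun setT (D n) by apply: measurable_funeM.
pose H x := (\sum_(0 <= n <oo) D n x)%E.
have H0 x : (0 <= H x)%E by exact: nneseries_ge0.
have mH : measurable_fun setT H by apply: ge0_emeasurable_sum.
have IH : (\int[mu]_x H x < +oo)%E.
  rewrite integral_nneseries//.
  apply: (@le_lt_trans _ _ (\sum_(0 <= n <oo) (2 / (2 ^ (n + 1))%:R : R)%:E)%E).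
    apply: lee_nneseries => n _; first by move=> _; exact: integral_ge0.
    rewrite ge0_integralZl ?lee_fin ?exprn_ge0//; last first.
      by move=> x _; rewrite lee_fin sqr_ge0.
    apply: (@le_trans _ _ ((4 ^+ n)%:E * (8 ^- n : R)%:E)%E).
      by rewrite lee_pmul2l// ?hf// lte_fin exprn_gt0.
    rewrite -EFinM lee_fin -exprVn -exprMn natrX addn1 exprS invfM mulrA divff// mul1r.
    by rewrite -exprVn lerXn2r ?nnegrE//; lra.
  rewrite [ltLHS](_ : _ = (2 / 2 ^+ 0 : R)%:E) ?ltry//.
  exact: (cvg_lim (@ereal_hausdorff R) (@cvg_geometric_eseries_half R 2 0)).
have aeH : {ae mu, forall x, setT x -> H x \is a fin_num}.
  apply: integrable_ae => //; apply/integrableP; split=> //.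
  by under eq_integral do rewrite gee0_abs//.
(* The upper limit is measurable and defined everywhere, including the null set where the sequence
   may diverge. *)
pose g x := fine (limn_esup (fun n => (f n x)%:E)).
have mg : measurable_fun setT g.
  apply: measurableT_comp => //; apply: measurable_fun_limn_esup => n.
  by apply/measurable_EFinP.
have fg x : H x \is a fin_num -> f ^~ x @ \oo --> g x.
  move=> Hx; suff /cvg_ex[l fl] : cvgn (f ^~ x).
    have /cvg_limn_einf_sup[_ e] : (fun n => (f n x)%:E) @ \oo --> l%:E.
      by apply: cvg_EFin => //; exact: nearW.
    by rewrite /g e.
  pose v n := f n.+1 x - f n x.
  have fv n : f n x = f 0%N x + series v n.
    by rewrite /series/= telescope_sumr// addrC subrK.
  suff cv : cvgn (series v).
    rewrite (_ : f ^~ x = fun n => f 0%N x + series v n); last exact/funext.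
    by apply: is_cvgD => //; exact: is_cvg_cst.
  apply: normed_cvg.
  apply: (@series_le_cvg _ _ (geometric (Num.sqrt (fine (H x))) 2^-1)).
  - by move=> n; exact: normr_ge0.
  - by move=> n; apply: geometric_ge0; rewrite ?sqrtr_ge0// invr_ge0.
  - move=> n /=; rewrite exprVn ler_pdivlMr ?exprn_gt0//.
    rewrite -(ger0_norm (exprn_ge0 n (ler0n R 2))) -normrM -sqrtr_sqr ler_wsqrtr//.
    rewrite -lee_fin fineK// (_ : (_)%:E = D n x).
      rewrite /H (nneseries_split 0 n.+1 (fun k _ => D0 k x)) add0n.
      rewrite big_nat_recr//= addeAC leeDr// adde_ge0//; last exact: nneseries_ge0.
      by rewrite sume_ge0.
    rewrite /D -EFinM exprMn -exprM mulnC exprM mulrC; congr (_ * _)%:E.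
      by congr (_ ^+ n); rewrite -natrX.
    by rewrite -sqrrN opprB.
  - apply: is_cvg_geometric_series; rewrite ger0_norm ?invr_ge0//.
    by rewrite invf_lt1// ltr1n.
(* Fatou's lemma in [p]; the index [maxn n p] keeps within the range [n <= p] of [hf]. *)
have hg n : (\int[mu]_x ((f n x - g x) ^+ 2)%:E <= ((8%:R ^- n : R)%:E))%E.
  rewrite (ae_eq_integral (fun x => limn_einf (fun p => ((f n x - f p x) ^+ 2)%:E)))//.
  - apply: (le_trans (fatou _ _ _ _)) => //.
      by move=> p x _; rewrite lee_fin sqr_ge0.
    rewrite limn_einf_lim; apply: lime_le; first exact: is_cvg_einfs.
    apply: nearW => p; apply: le_trans (hf n (maxn n p) (leq_maxl _ _)).
    by apply: ereal_inf_lbound; exists (maxn n p) => //=; exact: leq_maxr.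
  - apply/measurable_EFinP; apply: measurable_funX; exact: measurable_funB.
  - rewrite /limn_einf; apply: measurableT_comp => //.
    apply: measurable_fun_limn_esup => p; exact: measurableT_comp.
  - apply: filterS aeH => x /(_ I) /fg fgx _.
    have /cvg_limn_einf_sup[-> //] : (fun p => ((f n x - f p x) ^+ 2)%:E) @ \oo -->
        ((f n x - g x) ^+ 2)%:E.
    apply: cvg_EFin; first exact: nearW.
    under eq_fun do rewrite expr2; rewrite expr2.
    by apply: cvgM; apply: cvgB => //; exact: cvg_cst.
exists g => //; have fg2 : (f 0%N - g) \in Lfun mu 2.
  apply/Lfun2P; split; first exact: measurable_funB.
  by rewrite (le_lt_trans (hg 0%N))// ltry.
rewrite (_ : g = -1 *: (f 0%N - g) + f 0%N); last by rewrite scaleN1r opprB subrK.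
exact: (Lfun_submod_closed mu (lee1n 2)).2.
Qed.
End L2_complete.

Section jet_complete.
Context {R : realType} {m : nat}.
Implicit Types w z : jet R m.

Lemma jet_sqr_fin w j : (\int[lebesgue_rV m]_x (w j x ^+ 2)%:E)%E =
  (\int[lebesgue_rV m]_x (w j x * w j x))%:E.
Proof.
have I0 : (0 <= \int[lebesgue_rV m]_x (w j x ^+ 2)%:E)%E.
  by apply: integral_ge0 => x _; rewrite lee_fin sqr_ge0.
have [_ Ioo] := (Lfun2P _ _).1 (LfunP (w j)).
rewrite /Rintegral (_ : \int[_]_x _ = \int[lebesgue_rV m]_x (w j x ^+ 2)%:E)%E.
  by rewrite fineK// ge0_fin_numE.
by apply: eq_integral => x _; rewrite expr2.
Qed.

Lemma jet_sqr_le w j :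
  (\int[lebesgue_rV m]_x (w j x ^+ 2)%:E <= (jnorm w ^+ 2)%:E)%E.
Proof.
rewrite jet_sqr_fin lee_fin jnorm_sqr /jdot (bigD1 j)//= lerDl sumr_ge0// => i _.
by apply: Rintegral_ge0 => x _; rewrite -expr2 sqr_ge0.
Qed.

Lemma jnorm_sqr_le w e :
  (forall j, (\int[lebesgue_rV m]_x (w j x ^+ 2)%:E <= e%:E)%E) ->
  jnorm w ^+ 2 <= m.+1%:R * e.
Proof.
move=> h; rewrite jnorm_sqr /jdot.
rewrite (@le_trans _ _ (\sum_(j : option 'I_m) e))//.
  by apply: ler_sum => j _; rewrite -lee_fin -jet_sqr_fin.
by rewrite sumr_const card_option card_ord mulr_natl.
Qed.

Lemma L2jet_norm_jclass w : `|jclass w| = jnorm w.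
Proof. exact: jnorm_jrepr. Qed.

Lemma jclassB w z : jclass (w - z) = jclass w - jclass z.
Proof. by rewrite -scaleN1r jclassD jclassZ scaleN1r. Qed.

Lemma L2jet_complete (F : set_system (L2jet R m)) :
  ProperFilter F -> cauchy F -> cvg F.
Proof.
move=> PF cF.
(* Balls of radii [e n] and [e p] in the filter meet, so for [n <= p] their centres are at distance
   at most 4^-n; squared, this is 16^-n <= 8^-n, the rate asked by [L2_complete]. *)
pose e n : R := 4 ^- n / 2.
have e0 n : 0 < e n by rewrite divr_gt0// invr_gt0 exprn_gt0.
have /choice[u hu] : forall n, exists u : L2jet R m, F (ball u (e n)).
  by move=> n; apply: (cauchyP F).1.
have uu n p : (n <= p)%N -> `|u n - u p| ^+ 2 <= 8 ^- n.
  move=> np; have [v [vn vp]] := filter_ex (filterI (hu n) (hu p)).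
  move: vn vp; rewrite -!ball_normE /= => vn vp.
  have : `|u n - u p| <= 4 ^- n.
    rewrite -(subrK v (u n)) -addrA (le_trans (ler_normD _ _))//.
    rewrite [leRHS]splitr lerD ?(ltW vn)// distrC (le_trans (ltW vp))//.
    by rewrite ler_pM2r ?invr_gt0// lef_pV2 ?posrE ?exprn_gt0// ler_weXn2l//; lra.
  move=> h; apply: (@le_trans _ _ ((4 ^- n) ^+ 2)).
    by rewrite lerXn2r ?nnegrE// invr_ge0 exprn_ge0.
  rewrite exprVn -exprM mulnC exprM lef_pV2 ?posrE ?exprn_gt0//.
  by rewrite lerXn2r ?nnegrE//; lra.
have /choice[g hg] : forall j, exists g : LfunType (lebesgue_rV m) (lee1n 2),
    forall n, (\int[lebesgue_rV m]_x ((jrepr (u n) j x - g x) ^+ 2)%:E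
               <= ((8%:R ^- n : R)%:E))%E.
  move=> j; have [|n p np|g g2 hg] := @L2_complete _ _ R (lebesgue_rV m)
      (fun n => jrepr (u n) j).
  - by move=> n; exact: LfunP.
  - apply: (le_trans (jet_sqr_le (jrepr (u n) - jrepr (u p)) j)).
    by rewrite lee_fin -L2jet_norm_jclass jclassB !jreprK uu.
  - by exists (Lfun_Sub (lee1n 2) g2).
have ug n : `|u n - jclass g| ^+ 2 <= m.+1%:R * 8 ^- n.
  rewrite -(jreprK (u n)) -jclassB L2jet_norm_jclass; apply: jnorm_sqr_le => j.
  exact: hg.
apply/cvg_ex; exists (jclass g).
apply/cvg_ballP => r r0.
have [n [en gn]] : exists n, e n < r / 2 /\ m.+1%:R * 8 ^- n < (r / 2) ^+ 2.
  have c1 : 8^-1 ^+ n @[n --> \oo] --> (0 : R).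
    by apply: cvg_expr; rewrite ger0_norm// invf_lt1// ltr1n.
  have c2 : m.+1%:R * 8^-1 ^+ n @[n --> \oo] --> m.+1%:R * (0 : R) by exact: cvgMl_tmp.
  have c3 : 4^-1 ^+ n / 2 @[n --> \oo] --> (0 : R) / 2.
    by apply: cvgMr_tmp; apply: cvg_expr; rewrite ger0_norm// invf_lt1// ltr1n.
  move: c2 c3; rewrite mulr0 mul0r => c2 c3.
  have r1 : 0 < r / 2 by rewrite divr_gt0.
  have n2 : \forall n \near \oo, m.+1%:R * 8^-1 ^+ n < (r / 2) ^+ 2.
    by apply: (cvgr_lt _ c2); rewrite exprn_gt0.
  have n3 : \forall n \near \oo, 4^-1 ^+ n / 2 < r / 2 by exact: (cvgr_lt _ c3).
  have [n [h2 h3]] := filter_ex (filterI n2 n3).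
  by exists n; rewrite /e -!exprVn; split; [exact: h3|exact: h2].
apply: filterS (hu n) => v; rewrite -!ball_normE /= => uv.
rewrite -(subrK (u n) (jclass g)) -addrA (le_lt_trans (ler_normD _ _))//.
rewrite [ltRHS]splitr ltrD//; last exact: lt_trans en.
rewrite distrC -(@ltr_pXn2r _ 2)// ?nnegrE//; last by rewrite divr_ge0// ltW.
exact: le_lt_trans gn.
Qed.

HB.instance Definition _ := Uniform_isComplete.Build (L2jet R m) L2jet_complete.

Lemma H10_complete (D : set 'rV[R]_m) (F : set_system (H10 D)) :
  ProperFilter F -> cauchy F -> cvg F.
Proof.
move=> PF cF; pose G := (@H10_jet R m D : H10 D -> L2jet R m) @ F.
have cG : cvg G.
  apply: cauchy_cvg; apply: (cauchyP G).2 => e e0.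
  have [u Fu] := (cauchyP F).1 cF e e0.
  exists (H10_jet u).
  suff : F [set v : H10 D | ball (H10_jet u) e (H10_jet v)] by [].
  apply: filterS Fu => v uv.
  have h : `|u - v| < e by move: uv; rewrite -ball_normE.
  by rewrite /= -ball_normE; exact: h.
have [U GU] := (cvg_ex _).1 cG.
have hU : U \in in_H10 D.
  rewrite inE [X in X U](closure_id _).1; last exact: closed_closure.
  move=> B /GU GB; have [v Bv] := @filter_ex _ F _ _ GB.
  by exists (H10_jet v); split=> //; have := valP v; rewrite inE.
apply/cvg_ex; exists (MkH10 hU).
apply/cvg_ballP => e e0.
have /cvg_ballP /(_ e e0) := GU.
move=> h; have {}h : F [set v : H10 D | ball U e (H10_jet v)] by [].
apply: filterS h => v /=; rewrite -!ball_normE; exact.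
Qed.

HB.instance Definition _ D := Uniform_isComplete.Build (H10 D) (@H10_complete D).

End jet_complete.

(** * Diffusion forms *)

Section bounded_multiplier.
Context d (T : measurableType d) (R : realType) (mu : {measure set T -> \bar R}).

Lemma Lfun_infty_bounded (c : T -> R) : c \in Lfun mu +oo ->
  measurable_fun setT c /\ exists2 M : R, 0 <= M & {ae mu, forall x, `|c x| <= M}.
Proof.
move=> /andP[/[!inE] /= mc hc]; split=> //.
move: hc; rewrite /finite_norm unlock; case: ifPn => [mu0 hc|].
  exists (Num.max 0 (fine (ess_sup mu (abse \o (EFin \o c))))).
    by rewrite le_max lexx.
  apply: filterS (ess_sup_ge mu (abse \o (EFin \o c))) => x /=.
  case: (ess_sup _ _) hc => //= r _; rewrite lee_fin => h.
  by rewrite le_max h orbT.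
(* For a null measure the norm is 0 by convention, and any bound holds almost everywhere. *)
rewrite -leNgt => mu0 _; exists 0 => //.
exists setT; split=> //.
by apply/eqP; rewrite eq_le mu0 measure_ge0.
Qed.

Lemma Lfun2_multiplier (c f : T -> R) (M : R) : measurable_fun setT c -> 0 <= M ->
    {ae mu, forall x, `|c x| <= M} -> f \in Lfun mu 2 ->
  (c \* f) \in Lfun mu 2 /\
  (\int[mu]_x ((c x * f x) ^+ 2)%:E <= (M ^+ 2)%:E * \int[mu]_x (f x ^+ 2)%:E)%E.
Proof.
move=> mc M0 cM /Lfun2P[mf foo].
have mf2 : measurable_fun setT (fun x => (f x ^+ 2)%:E : \bar R).
  by apply/measurable_EFinP; exact: measurable_funX.
have mcf : measurable_fun setT (c \* f) by exact: measurable_funM.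
have le : (\int[mu]_x ((c x * f x) ^+ 2)%:E <= (M ^+ 2)%:E * \int[mu]_x (f x ^+ 2)%:E)%E.
  rewrite -ge0_integralZl ?lee_fin ?sqr_ge0//; last first.
    by move=> x _; rewrite lee_fin sqr_ge0.
  apply: ae_ge0_le_integral => //.
  - by move=> x _; rewrite lee_fin sqr_ge0.
  - by apply/measurable_EFinP; exact: measurable_funX.
  - by move=> x _; rewrite -EFinM lee_fin mulr_ge0// sqr_ge0.
  - exact: measurable_funeM.
  - apply: filterS cM => x cx _; rewrite -EFinM lee_fin exprMn ler_wpM2r ?sqr_ge0//.
    by rewrite -[leLHS]real_normK ?num_real// lerXn2r ?nnegrE.
split=> //; apply/Lfun2P; split=> //.
rewrite (le_lt_trans le)// lte_mul_pinfty// ?lee_fin ?sqr_ge0//.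
Qed.

Lemma Rintegral_sum (I : Type) (r : seq I) (f : I -> T -> R) :
  (forall i, mu.-integrable setT (EFin \o f i)) ->
  (\int[mu]_x (\sum_(i <- r) f i x) = \sum_(i <- r) \int[mu]_x (f i x))%R.
Proof.
move=> fi; elim: r => [|i r IH].
  rewrite big_nil; under eq_Rintegral do rewrite big_nil.
  by rewrite /Rintegral integral0.
rewrite big_cons -IH; under eq_Rintegral do rewrite big_cons.
rewrite RintegralD//; rewrite (_ : _ \o _ = (fun x => \sum_(j <- r) (f j x)%:E)%E).
  by apply: integrable_sum => // j _; exact: fi.
by apply/funext => x /=; rewrite sumEFin.
Qed.

End bounded_multiplier.

Section integrable_EFin.
Context d (T : measurableType d) (R : realType) (mu : {measure set T -> \bar R}).
Implicit Types f g : T -> R.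

Lemma integrable_EFinZl (k : R) f : mu.-integrable setT (EFin \o f) ->
  mu.-integrable setT (EFin \o (fun x => k * f x)).
Proof. by move=> fi; exact: (integrableZl measurableT k fi). Qed.

Lemma integrable_EFin_sum (I : Type) (r : seq I) (f : I -> T -> R) :
  (forall i, mu.-integrable setT (EFin \o f i)) ->
  mu.-integrable setT (EFin \o (fun x => \sum_(i <- r) f i x)).
Proof.
move=> fi; rewrite (_ : _ \o _ = (fun x => \sum_(i <- r) (EFin \o f i) x)%E).
  by apply: integrable_sum => // i _; exact: fi.
by apply/funext => x /=; rewrite sumEFin.
Qed.

End integrable_EFin.

Lemma big_option_ord (R : nmodType) m (F : option 'I_m -> R) :
  \sum_j F j = F None + \sum_i F (Some i).
Proof.
rewrite (bigD1 None)//= (reindex_omap Some id)/=; last by case.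
by congr (_ + _); apply: eq_bigl => i; rewrite /= eqxx.
Qed.

Section jet_form.
Context {R : realType} {m : nat} (D : set 'rV[R]_m).
Implicit Types (c : 'rV[R]_m -> R) (w z : jet R m).
Let leb := @lebesgue_rV R m.

Definition jform c w z : R :=
  \sum_i (\int[leb]_x ((c \_ D) x * (w (Some i) x * z (Some i) x)))%R.

Lemma jformC c w z : jform c w z = jform c z w.
Proof.
by apply: eq_bigr => i _; apply: eq_Rintegral => x _; rewrite (mulrC (w _ _)).
Qed.

(** Multiplying the gradient part of [z] by [c] and discarding its function part writes the form as
    [jdot w cz]. Boundedness and independence of representatives are then inherited from [jdot]. *)
Lemma jform_multiplier c : Linfty D c -> exists2 M, 0 <= M & forall z,
  exists cz : jet R m, [/\ jnorm cz <= M * jnorm z,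
    forall x, cz None x = 0 &
    forall i x, cz (Some i) x = (c \_ D) x * z (Some i) x].
Proof.
move=> /Lfun_infty_bounded[mc [M M0 cM]]; exists M => // z.
have h i := Lfun2_multiplier mc M0 cM (LfunP (z (Some i))).
pose cz : jet R m := fun j => if j is Some i then Lfun_Sub (lee1n 2) (h i).1 else 0.
exists cz; split=> //.
rewrite -(@ler_pXn2r _ 2)// ?nnegrE ?mulr_ge0 ?jnorm_ge0//.
rewrite exprMn !jnorm_sqr /jdot mulr_sumr; apply: ler_sum => -[i|] _.
  by rewrite -lee_fin EFinM -!jet_sqr_fin; case: (h i).
rewrite (_ : (\int[_]_x _)%R = 0).
  by rewrite mulr_ge0 ?sqr_ge0// Rintegral_ge0// => x _; rewrite -expr2 sqr_ge0.
rewrite /Rintegral (_ : (\int[_]_x _)%E = 0%E)//; apply: integral0_eq => x _ /=.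
by rewrite mulr0.
Qed.

Lemma jform_integrable c w z i : Linfty D c ->
  leb.-integrable setT (EFin \o (fun x => (c \_ D) x * (w (Some i) x * z (Some i) x))).
Proof.
move=> /jform_multiplier[M M0 /(_ z)[cz [_ _ hcz]]].
have : leb.-integrable setT (EFin \o (w (Some i) \* cz (Some i))).
  by apply/Lfun1_integrable/Lfun2_mul_Lfun1; exact: LfunP.
by congr (_.-integrable _ _); apply/funext => x /=; rewrite hcz mulrCA.
Qed.

Lemma jform_jdot c : Linfty D c -> exists2 M, 0 <= M & forall z,
  exists2 cz : jet R m, jnorm cz <= M * jnorm z & forall w, jform c w z = jdot w cz.
Proof.
move=> /jform_multiplier[M M0 h]; exists M => // z.
have [cz [czM cz0 czi]] := h z; exists cz => // w.
rewrite /jdot big_option_ord [X in X + _](_ : _ = 0) ?add0r.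
  by apply: eq_bigr => i _; apply: eq_Rintegral => x _; rewrite czi mulrCA.
rewrite /Rintegral (_ : (\int[_]_x _)%E = 0%E)//; apply: integral0_eq => x _ /=.
by rewrite cz0 mulr0.
Qed.

Lemma jdot_le w z : `|jdot w z| <= jnorm w * jnorm z.
Proof.
by rewrite /jnorm -sqrtrM ?jdot_ge0// -sqrtr_sqr ler_wsqrtr// jdot_CauchySchwarz.
Qed.

Lemma eq_jdotl w w' z : jclass w = jclass w' -> jdot w z = jdot w' z.
Proof.
move=> /jclass_eq ww; apply/eqP; rewrite -subr_eq0 -normr_le0.
have := jdot_le (w - w') z.
by rewrite ww mul0r -scaleN1r addrC jdotDl jdotZl mulN1r addrC.
Qed.

(** [diffusion] is computed on the representatives picked by [jrepr], which need be neither linear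
    nor smooth; this frees their choice for linear combinations and test functions. *)
Lemma diffusion_jform c (u v : H10 D) (w z : jet R m) : Linfty D c ->
  jclass w = H10_jet u -> jclass z = H10_jet v -> diffusion c u v = jform c w z.
Proof.
move=> hc wu zv; have [M _ hM] := jform_jdot hc.
have eql a a' b : jclass a = jclass a' -> jform c a b = jform c a' b.
  by move=> aa; have [cb _ hcb] := hM b; rewrite !hcb; exact: eq_jdotl.
transitivity (jform c (jrepr (H10_jet u)) (jrepr (H10_jet v))).
  rewrite /diffusion Rintegral_mkcond /jform -Rintegral_sum; last first.
    by move=> i; exact: jform_integrable.
  apply: eq_Rintegral => x _; rewrite patchE -mulr_sumr patchE.
  case: ifP => _; last by rewrite mul0r.
  by congr (_ * _); apply: eq_bigr => i _; rewrite !mxE.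
rewrite (eql _ w) ?jreprK// jformC [RHS]jformC.
by apply: eql; rewrite jreprK.
Qed.

Lemma diffusionC c (u v : H10 D) : diffusion c u v = diffusion c v u.
Proof.
rewrite /diffusion; apply: eq_Rintegral => x _; congr (_ * _).
by apply: eq_bigr => i _; rewrite mulrC.
Qed.

Lemma diffusion_bounded_bilinear c : Linfty D c ->
  bounded_bilinear (@diffusion R m D c).
Proof.
move=> hc; have [M M0 hM] := jform_jdot hc; split=> [t u u' v|].
  pose w := jrepr (H10_jet u); pose w' := jrepr (H10_jet u').
  rewrite (@diffusion_jform c _ v (t *: w + w') (jrepr (H10_jet v)))//; last 2 first.
  - by rewrite jclassD jclassZ !jreprK.
  - by rewrite jreprK.
  rewrite (@diffusion_jform c u v w (jrepr (H10_jet v))) ?jreprK//.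
  rewrite (@diffusion_jform c u' v w' (jrepr (H10_jet v))) ?jreprK//.
  have [cz _ hcz] := hM (jrepr (H10_jet v)).
  by rewrite !hcz jdotDl jdotZl.
exists M => // u v.
rewrite (@diffusion_jform c u v (jrepr (H10_jet u)) (jrepr (H10_jet v))) ?jreprK//.
have [cz czM ->] := hM (jrepr (H10_jet v)).
apply: (le_trans (jdot_le _ _)).
apply: (le_trans (ler_wpM2l (jnorm_ge0 _) czM)).
by rewrite mulrCA mulrA.
Qed.

End jet_form.

(** * Poincare inequality and coercivity *)

Lemma poincare_1d (R : realType) (g g' : R -> R) (L : R) : 0 < L ->
    (forall t : R, is_derive t (1 : R) g (g' t)) -> continuous g' ->
    (forall t, L <= `|t| -> g t = 0) ->
  (\int[lebesgue_measure]_t (g t ^+ 2)%:E <=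
   (4 * L ^+ 2)%:E * \int[lebesgue_measure]_t (g' t ^+ 2)%:E)%E.
Proof.
move=> L0 dg cg' g0; have cg : continuous g.
  move=> t; apply: differentiable_continuous; apply/derivable1_diffP.
  exact: ex_derive.
(* g^2 <= 2 (t g^2)' + 4 t^2 g'^2, and the first term integrates to 0. *)
pose h (t : R) := t * g t ^+ 2; pose f (t : R) := g t ^+ 2 + 2 * t * (g t * g' t).
have dh (t : R) : is_derive t (1 : R) h (f t).
  have := dg t => dgt; rewrite /h; apply: is_derive_eq.
  by rewrite /f /GRing.scale /=; ring.
have cg2 : continuous (fun t => g t ^+ 2).
  by move=> t; under eq_fun do rewrite expr2; apply: cvgM; exact: cg.
have cg'2 : continuous (fun t => g' t ^+ 2).
  by move=> t; under eq_fun do rewrite expr2; apply: cvgM; exact: cg'.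
have cf : continuous f.
  move=> t; apply: cvgD; first exact: cg2.
  apply: cvgM; first by apply: cvgMl_tmp; exact: cvg_id.
  by apply: cvgM; [exact: cg|exact: cg'].
have ch : continuous h by move=> t; apply: cvgM; [exact: cvg_id|exact: cg2].
have NLL : - L < L by rewrite gtrN.
have If : (\int[lebesgue_measure]_(t in `[(- L)%R, L]) (f t)%:E = 0)%E.
  rewrite (@continuous_FTC2 R f h)//.
  - have gL : g L = 0 by apply: g0; rewrite ger0_norm// ltW.
    have gNL : g (- L) = 0 by apply: g0; rewrite normrN ger0_norm// ltW.
    by rewrite /h gL gNL expr0n /= !mulr0 subee.
  - exact: continuous_subspaceT.
  - split.
    + by move=> t _; exact: ex_derive.
    + by apply: cvg_at_right_filter; exact: ch.
    + by apply: cvg_at_left_filter; exact: ch.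
  - by move=> t _; rewrite derive1E; exact: derive_val.
have cint (k : R -> R) : continuous k ->
    lebesgue_measure.-integrable `[(- L)%R, L] (EFin \o k).
  move=> ck; apply: continuous_compact_integrable; first exact: segment_compact.
  exact: continuous_subspaceT.
have mk (k : R -> R) (A : set (measurableTypeR R)) : continuous k -> measurable_fun A (EFin \o k).
  move=> ck; apply/measurable_EFinP; apply: measurable_funTS.
  exact: continuous_measurable_fun.
rewrite (_ : \int[_]_t _ = \int[lebesgue_measure]_(t in `[(- L)%R, L]) (g t ^+ 2)%:E)%E; last first.
  rewrite [RHS]integral_mkcond; apply: eq_integral => t _; rewrite patchE.
  case: ifPn => //; rewrite notin_setE /= in_itv /= => tL.
  rewrite g0 ?expr0n//; move: tL => /negP; rewrite -ler_norml -ltNge.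
  exact: ltW.
apply: (@le_trans _ _ (\int[lebesgue_measure]_(t in `[(- L)%R, L])
    (2%:E * (f t)%:E + (4 * L ^+ 2)%:E * (g' t ^+ 2)%:E))%E).
  apply: ge0_le_integral => //.
  - by move=> t _; rewrite lee_fin sqr_ge0.
  - exact: mk.
  - apply: emeasurable_funD; apply: measurable_funeM; exact: mk.
  - move=> t; rewrite /= in_itv /= -ler_norml => tL.
    rewrite -!EFinM -EFinD lee_fin -subr_ge0.
    have t2 : t ^+ 2 <= L ^+ 2.
      by rewrite -[leLHS]real_normK ?num_real// lerXn2r ?nnegrE// ltW.
    rewrite (_ : _ - _ = (g t + 2 * t * g' t) ^+ 2 +
      4 * ((L ^+ 2 - t ^+ 2) * g' t ^+ 2)); last by rewrite /f; ring.
    by rewrite addr_ge0 ?sqr_ge0// mulr_ge0// mulr_ge0 ?sqr_ge0 ?subr_ge0.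
have i1 := cint _ cf; have i2 := cint _ cg'2.
rewrite integralD//; [|exact: integrableZl|exact: integrableZl].
rewrite !integralZl// If mule0 add0e lee_pmul2l// ?lte_fin ?mulr_gt0 ?exprn_gt0//.
apply: ge0_subset_integral => //; first exact: mk.
by move=> t _; rewrite lee_fin sqr_ge0.
Qed.

Lemma is_derive_line (R : realType) n (phi : 'rV[R]_n -> R) (gamma : R -> 'rV[R]_n)
    (e : 'rV[R]_n) (t : R) :
  (forall s h, gamma (h + s) = h *: e + gamma s) ->
  differentiable phi (gamma t) ->
  is_derive t (1 : R) (phi \o gamma) ('D_e phi (gamma t)).
Proof.
move=> ge dphi; have Q : (fun h : R => h^-1 *: (((phi \o gamma) \o shift t) (h *: (1:R)) - (phi \o gamma) t))
  = (fun h => h^-1 *: ((phi \o shift (gamma t)) (h *: e) - phi (gamma t))).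
  by apply/funext => h /=; rewrite ge /GRing.scale /= mulr1.
have D : derivable phi (gamma t) e by exact: diff_derivable.
by split; rewrite /derivable /derive Q.
Qed.

Lemma coord_le_norm (R : realType) n (x : 'rV[R]_n) i : `|x ord0 i| <= `|x|.
Proof.
rewrite [leRHS]mx_normrE.
exact: (le_bigmax 0 (fun ij : 'I_1 * 'I_n => `|x ij.1 ij.2|) (ord0, i)).
Qed.

Section poincare.
Context {R : realType} {n : nat} (D : set 'rV[R]_n.+1).

(** By Tonelli, [poincare_1d] is applied on each line parallel to the first axis, so a single
    partial derivative suffices. Measurability is assumed since the caller has it from the L^2
    representatives. *)
Lemma poincare_test_function (phi : 'rV[R]_n.+1 -> R) (L : R) : 0 < L ->
    (forall x, D x -> `|x| < L) -> test_function D phi ->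
    measurable_fun setT phi -> measurable_fun setT (partials [:: ord0] phi) ->
  (\int[lebesgue_rV n.+1]_x (phi x ^+ 2)%:E <=
   (4 * L ^+ 2)%:E * \int[lebesgue_rV n.+1]_x (partials [:: ord0] phi x ^+ 2)%:E)%E.
Proof.
move=> L0 DL [sphi _ supp] mphi mdphi.
have tonelli (k : 'rV[R]_n.+1 -> R) : measurable_fun setT k ->
    measurable_fun setT (fun p => (k (consrV p) ^+ 2)%:E : \bar R) /\
    (\int[lebesgue_rV n.+1]_x (k x ^+ 2)%:E =
     \int[lebesgue_rV n]_y fubini_G lebesgue_measure (fun p => (k (consrV p) ^+ 2)%:E) y)%E.
  move=> mk; have mk2 : measurable_fun setT (fun x => (k x ^+ 2)%:E : \bar R).
    by apply/measurable_EFinP; exact: measurable_funX.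
  have mc : measurable_fun setT (fun p => (k (consrV p) ^+ 2)%:E : \bar R).
    exact: (measurableT_comp mk2 (@measurable_consrV R n)).
  split=> //; rewrite -fubini_tonelli2//; last first.
    by move=> p; rewrite lee_fin sqr_ge0.
  rewrite /= /lebesgueS (ge0_integral_pushforward (@measurable_consrV R n))//.
  by move=> x _; rewrite lee_fin sqr_ge0.
have [mp ->] := tonelli _ mphi; have [md ->] := tonelli _ mdphi.
have sq0 (k : 'rV[R]_n.+1 -> R) p : (0 <= (k (consrV p) ^+ 2)%:E)%E.
  by rewrite lee_fin sqr_ge0.
rewrite -ge0_integralZl//; last 3 first.
- exact: measurable_fun_fubini_tonelli_G.
- by move=> y _; apply: integral_ge0.
- by rewrite lee_fin mulr_ge0// sqr_ge0.
apply: ge0_le_integral => //.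
- by move=> y _; apply: integral_ge0.
- exact: measurable_fun_fubini_tonelli_G.
- by apply: measurable_funeM; exact: measurable_fun_fubini_tonelli_G.
move=> y _; pose gamma (t : R) : 'rV[R]_n.+1 := consrV (t, y).
have ge s h : gamma (h + s) = h *: delta_mx ord0 ord0 + gamma s.
  apply/rowP => i; rewrite !mxE; case: unliftP => [j|] -> /=.
    by rewrite mulr0 add0r.
  by rewrite mulr1.
have dpar s (t : R) : is_derive t (1 : R) (partials s phi \o gamma) (partials (ord0 :: s) phi (gamma t)).
  exact: is_derive_line.
apply: (poincare_1d L0 (dpar [::])).
  move=> t; apply: (@differentiable_continuous _ _ _ t); apply/derivable1_diffP.
  by have := dpar [:: ord0] t => ?; exact: ex_derive.
move=> t tL; apply/eqP; apply: contraTT tL => phi0; rewrite -ltNge.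
have gD : D (gamma t) by apply: supp; apply: subset_closure.
apply: le_lt_trans (DL _ gD).
have {1}-> : t = gamma t ord0 ord0 by rewrite mxE unlift_none.
exact: coord_le_norm.
Qed.
End poincare.

Lemma test_jet_in_H10 (R : realType) m (D : set 'rV[R]_m) v :
  test_jets D v -> v \in in_H10 D.
Proof. by move=> tv; rewrite inE; exact: subset_closure. Qed.

Lemma partials_outside (R : realType) m (D : set 'rV[R]_m) phi i x :
  test_function D phi -> ~ D x -> partials [:: i] phi x = 0.
Proof.
move=> [_ _ sD] Dx.
have Cx : (~` closure [set x | phi x != 0]) x by move=> /sD.
have oC : open (~` closure [set x | phi x != 0]) by apply: closed_openC; exact: closed_closure.
have phi0 : \forall z \near x, phi z = cst 0 z.
  near=> z; apply/eqP/negPn/negP => z0.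
  have : (~` closure [set x | phi x != 0]) z by near: z; exact: open_nbhs_nbhs.
  by apply; exact: subset_closure.
rewrite /= (near_eq_derive _ phi0) ?derive_cst//.
Unshelve. all: by end_near. Qed.

Section diffusion_coercive.
Context {R : realType} {n d : nat} (D : set 'rV[R]_n.+1).
Variables (abar : 'rV[R]_n.+1 -> R) (psi : 'I_d -> 'rV[R]_n.+1 -> R).
Hypotheses (habar : Linfty D abar) (hpsi : forall i, Linfty D (psi i)).
Variables (lo L : R).
Hypotheses (lo0 : 0 < lo) (L0 : 0 < L) (DL : forall x, D x -> `|x| < L).
Variable y : 'rV[R]_d.
Hypothesis hlo : forall x, D x -> lo <= affine_coef abar psi y x.
Let leb := @lebesgue_rV R n.+1.

(** By Poincare, the squared H^1-norm is at most 1 + 4 L^2 times the squared norm of the gradient,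
    whence the constant. Ellipticity is known on [D] only; the pointwise vanishing of the gradient
    of a test function outside [D] covers the rest. *)
Lemma jform_coercive (w : jet R n.+1) phi : test_function D phi -> jet_of phi w ->
  lo / (1 + 4 * L ^+ 2) * jnorm w ^+ 2 <=
  jform D abar w w - \sum_k y ord0 k * jform D (psi k) w w.
Proof.
move=> tphi [w0 wi].
pose E i := (\int[leb]_x (w (Some i) x * w (Some i) x))%R.
have E0 i : 0 <= E i by apply: Rintegral_ge0 => x _; rewrite -expr2 sqr_ge0.
have P : jnorm w ^+ 2 <= (1 + 4 * L ^+ 2) * \sum_i E i.
  rewrite jnorm_sqr /jdot big_option_ord mulrDl mul1r addrC lerD2l.
  have phiE : phi = w None by apply/funext => x; rewrite w0.
  have dphiE : partials [:: ord0] phi = w (Some ord0).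
    by apply/funext => x; rewrite wi.
  have := poincare_test_function L0 DL tphi; rewrite phiE in dphiE *.
  rewrite dphiE => /(_ _ _) h.
  rewrite (@le_trans _ _ (4 * L ^+ 2 * E ord0))//.
    by rewrite -lee_fin EFinM -!jet_sqr_fin h.
  apply: ler_wpM2l; first by rewrite mulr_ge0// sqr_ge0.
  by rewrite (bigD1 ord0)//= lerDl sumr_ge0.
have c0 : 0 < 1 + 4 * L ^+ 2 by rewrite ltr_wpDr// mulr_ge0// sqr_ge0.
rewrite mulrAC ler_pdivrMr//.
apply: (@le_trans _ _ (lo * (\sum_i E i) * (1 + 4 * L ^+ 2))).
  by rewrite -mulrA ler_pM2l// mulrC.
rewrite ler_pM2r// mulr_sumr.
have -> : \sum_k y ord0 k * jform D (psi k) w w = \sum_i \sum_k y ord0 k *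
    (\int[leb]_x ((psi k \_ D) x * (w (Some i) x * w (Some i) x)))%R.
  by rewrite exchange_big; apply: eq_bigr => k _; rewrite -mulr_sumr.
rewrite -sumrB /=; apply: ler_sum => i _.
have iw : leb.-integrable setT (EFin \o (fun x => w (Some i) x * w (Some i) x)).
  by apply/Lfun1_integrable/Lfun2_mul_Lfun1; exact: LfunP.
have ia := @jform_integrable R n.+1 D abar w w i habar.
have ip k := @jform_integrable R n.+1 D (psi k) w w i (hpsi k).
have ip' k := integrable_EFinZl (y ord0 k) (ip k).
have isum := integrable_EFin_sum (index_enum 'I_d) ip'.
rewrite /E -RintegralZl//.
under [in leRHS]eq_bigr => k _ do rewrite -(RintegralZl (y ord0 k) measurableT (ip k)).
rewrite -Rintegral_sum// -RintegralB//.
apply: le_Rintegral => //.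
- exact: integrable_EFinZl.
- exact: (integrableB measurableT ia isum).
move=> x _; have [Dx|Dx] := pselect (D x); last first.
  by rewrite wi (partials_outside _ tphi)// mulr0 !mulr0 big1 ?subr0// => k _; rewrite !mulr0.
rewrite patchE mem_set//; under eq_bigr do rewrite patchE mem_set// mulrA.
rewrite -mulr_suml -mulrBl; apply: ler_wpM2r; last exact: hlo.
by rewrite -expr2 sqr_ge0.
Qed.

Lemma diffusion_coercive (w : H10 D) : lo / (1 + 4 * L ^+ 2) * `|w| ^+ 2 <=
  diffusion abar w w - \sum_i y ord0 i * diffusion (psi i) w w.
Proof.
set c := lo / _; have c0 : 0 < c.
  by rewrite divr_gt0// ltr_wpDr// mulr_ge0// sqr_ge0.
pose B (w v : H10 D) := diffusion abar w v - \sum_i y ord0 i * diffusion (psi i) w v.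
have bB : bounded_bilinear B.
  apply: bounded_bilinear_pencil; first exact: diffusion_bounded_bilinear.
  by move=> i; exact: diffusion_bounded_bilinear.
have BC u v : B u v = B v u.
  rewrite /B; congr (_ - _); first exact: diffusionC.
  by apply: eq_bigr => i _; congr (_ * _); exact: diffusionC.
have [M M0 hM] := bilinear_bounded bB.
rewrite -/(B w w); apply/ler_addgt0Pr => eps eps0.
(* [e * K] is the total loss when [w] is replaced by a test jet [v] within [e]: 2 c e |w| in the
   squared norm ([h2]), and M e (2 |w| + 1) in the form ([h1]), where [e <= 1] bounds the norm of
   [w + v]. *)
pose K := 2 * c * `|w| + M * (2 * `|w| + 1).
have n1 : 0 <= 2 * `|w| + 1 by rewrite addr_ge0 ?mulr_ge0 ?normr_ge0.
have K0 : 0 <= K.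
  apply: addr_ge0; last exact: mulr_ge0.
  by apply: mulr_ge0; [apply: mulr_ge0 => //; exact: ltW|exact: normr_ge0].
pose e := Num.min 1 (eps / (K + 1)).
have K1 : 0 < K + 1 by rewrite ltr_wpDl.
have e0 : 0 < e by rewrite lt_min ltr01 divr_gt0.
have e1 : e <= 1 by rewrite ge_min lexx.
have eK : e * K <= eps.
  apply: (@le_trans _ _ (e * (K + 1))); first by rewrite ler_pM2l// lerDl.
  by rewrite -ler_pdivlMr// ge_min lexx orbT.
have [v0 tv wv] := in_H10P _ _ (valP w) e e0.
pose v : H10 D := MkH10 (test_jet_in_H10 tv).
have {}wv : `|w - v| < e by [].
have Qv : c * `|v| ^+ 2 <= B v v.
  move: (tv) => [z [phi tphi zphi] zv].
  have vz : jclass z = H10_jet v by rewrite zv.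
  have -> : `|v| = jnorm z by rewrite -L2jet_norm_jclass vz.
  rewrite /B (diffusion_jform habar vz vz).
  under eq_bigr do rewrite (diffusion_jform (hpsi _) vz vz).
  exact: (jform_coercive tphi zphi).
have vw : `|v| <= `|w| + e.
  by rewrite -(subrK w v) addrC (le_trans (ler_normD _ _))// lerD2l distrC ltW.
have wv' : `|w| <= `|v| + e.
  by rewrite -(subrK v w) addrC (le_trans (ler_normD _ _))// lerD2l ltW.
have h1 : B v v - B w w <= M * e * (2 * `|w| + 1).
  rewrite (_ : _ - _ = - B (w - v) (w + v)); last first.
    rewrite (bilinearB bB) BC (BC v) !(bilinearD bB) (BC w v).
    by ring.
  rewrite (le_trans (ler_norm _))// normrN (le_trans (hM _ _))//.
  apply: ler_pM => //; first by rewrite mulr_ge0.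
    by rewrite ler_wpM2l// ltW.
  rewrite (le_trans (ler_normD _ _))//; lra.
have h2 : `|w| ^+ 2 - 2 * e * `|w| <= `|v| ^+ 2.
  have [we|we] := leP e `|w|.
    have : (`|w| - e) ^+ 2 <= `|v| ^+ 2 by rewrite lerXn2r ?nnegrE ?subr_ge0// lerBlDr.
    by have := sqr_ge0 e; rewrite sqrrB; lra.
  apply: (@le_trans _ _ 0); last exact: sqr_ge0.
  have := normr_ge0 w; nra.
have h3 : c * `|w| ^+ 2 - 2 * c * e * `|w| <= B v v.
  apply: le_trans Qv; rewrite (_ : _ - _ = c * (`|w| ^+ 2 - 2 * e * `|w|)); last by ring.
  by rewrite ler_pM2l.
have : e * K = 2 * c * e * `|w| + M * e * (2 * `|w| + 1) by rewrite /K; ring.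
by move: h1 h3 eK; lra.
Qed.

End diffusion_coercive.

(** * Bochner integrals in a finite-dimensional span *)

Definition in_span (R : realType) (V : lmodType R) n (v : 'I_n -> V) (z : V) :=
  exists c : 'I_n -> R, z = \sum_i c i *: v i.

Lemma in_span_sum (R : realType) (V : lmodType R) n (v : 'I_n -> V) (I : Type)
    (r : seq I) (P : pred I) (F : I -> V) :
  (forall i, P i -> in_span v (F i)) -> in_span v (\sum_(i <- r | P i) F i).
Proof.
move=> h; elim/big_ind: _ => //.
  by exists (fun=> 0); rewrite big1// => i _; rewrite scale0r.
move=> _ _ [c ->] [c' ->]; exists (fun i => c i + c' i).
by rewrite -big_split; apply: eq_bigr => i _; rewrite scalerDl.
Qed.

Lemma in_spanZ (R : realType) (V : lmodType R) n (v : 'I_n -> V) t z :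
  in_span v z -> in_span v (t *: z).
Proof.
move=> [c ->]; exists (fun i => t * c i); rewrite scaler_sumr.
by apply: eq_bigr => i _; rewrite scalerA.
Qed.

Lemma in_span_gen (R : realType) (V : lmodType R) n (v : 'I_n -> V) i : in_span v (v i).
Proof.
exists (fun j => (j == i)%:R); rewrite (bigD1 i)//= eqxx scale1r big1 ?addr0//.
by move=> j /negbTE ->; rewrite scale0r.
Qed.

(** With more vectors than generators, the coefficient matrix has a nonzero left kernel, whose rows
    are linear relations between the [x i]. *)
Lemma lin_indep_in_span (R : realType) (V : normedModType R) n p (v : 'I_n -> V)
    (x : 'I_p -> V) : (forall i, in_span v (x i)) -> lin_indep x -> (p <= n)%N.
Proof.
move=> /choice[c xE] ind; rewrite leqNgt; apply/negP => np.
pose A := \matrix_(i < p, j < n) c i j.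
have : kermx A != 0.
  rewrite kermx_eq0 /row_free; apply/eqP => rA.
  by have := rank_leq_col A; rewrite rA leqNgt np.
move: (kermx A) (mulmx_ker A) => K KA.
apply/negP/negPn/eqP/matrixP => i j; rewrite [RHS]mxE.
apply: (ind (fun j => K i j)).
under eq_bigr do rewrite xE scaler_sumr.
rewrite exchange_big big1//= => l _.
under eq_bigr do rewrite scalerA.
rewrite -scaler_suml; have /matrixP/(_ i l) := KA.
rewrite !mxE; under eq_bigr do rewrite mxE.
by move=> ->; rewrite scale0r.
Qed.

Section bochner_span.
Context {R : realType} {d : nat} {V : normedModType R}.
Variable ip : V -> V -> R.
Hypotheses (bip : bounded_bilinear ip) (ipC : forall u v, ip u v = ip v u)
  (ip_norm : forall u, ip u u = `|u| ^+ 2).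

(** Gram-Schmidt, for a family that may be dependent: if the part [e] of [v ord0] orthogonal to the
    other vectors is zero, orthogonality to it is automatic, whatever [t] is. *)
Lemma orthogonal_projection n (v : 'I_n -> V) (z : V) :
  exists c : 'I_n -> R, forall j, ip (z - \sum_i c i *: v i) (v j) = 0.
Proof.
elim: n v z => [v z|n IH v z]; first by exists (fun=> 0) => -[].
have ip_sumr (x : V) (p : nat) (w : 'I_p -> V) (c : 'I_p -> R) :
    (forall j, ip x (w j) = 0) -> ip x (\sum_i c i *: w i) = 0.
  move=> h; rewrite ipC (bilinear_sum bip) big1// => i _.
  by rewrite (bilinearZ bip) ipC h mulr0.
pose v' i := v (lift ord0 i).
have [a ha] := IH v' (v ord0); have [b hb] := IH v' z.
set e := v ord0 - _ in ha; set z' := z - _ in hb.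
pose t := ip z' e / ip e e.
exists (fun i => if unlift ord0 i is Some j then b j - t * a j else t).
have -> : z - \sum_i (if unlift ord0 i is Some j then b j - t * a j else t) *: v i =
    z' - t *: e.
  rewrite big_ord_recl unlift_none; under eq_bigr do rewrite liftK scalerBl -scalerA.
  rewrite sumrB -scaler_sumr /z' /e scalerBr !opprD !opprK !addrA.
  by rewrite -!addrA; congr (_ + _); rewrite [RHS]addrCA.
have hj j : ip (z' - t *: e) (v' j) = 0.
  by rewrite (bilinearB bip) (bilinearZ bip) ha hb mulr0 subrr.
have he : ip (z' - t *: e) e = 0.
  rewrite (bilinearB bip) (bilinearZ bip) /t.
  have [e0|e0] := eqVneq (ip e e) 0; last by rewrite divfK// subrr.
  have : e == 0 by rewrite -normr_eq0 -sqrf_eq0 -ip_norm e0.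
  by move=> /eqP ->; rewrite (ipC z') (bilinear0 bip) !mul0r subrr.
move=> j; case: (unliftP ord0 j) => [k ->|->]; first exact: hj.
rewrite -[v ord0](subrK (\sum_i a i *: v' i)) ipC (bilinearD bip) ipC he add0r.
by rewrite ipC ip_sumr.
Qed.

Variable mu : probability 'rV[R]_d R.

(* The component x of z orthogonal to the span is orthogonal to g, hence almost
   orthogonal to the integrals of simple functions approximating z. *)
Lemma bochner_integral_in_span n (v : 'I_n -> V) (g : 'rV[R]_d -> V) (z : V) :
  (forall y, in_span v (g y)) -> is_bochner_integral mu g z -> in_span v z.
Proof.
move=> gv hz; have [c hc] := orthogonal_projection v z; exists c.
apply/eqP; rewrite -subr_eq0; apply/eqP; set x := z - _ in hc *.
have ipx w : in_span v w -> ip w x = 0.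
  move=> [a ->]; rewrite (bilinear_sum bip) big1// => i _.
  by rewrite (bilinearZ bip) ipC hc mulr0.
have [M M0 hM] := bilinear_bounded bip.
suff h (e : R) : 0 < e -> `|x| ^+ 2 <= 0 + e.
  apply/eqP; rewrite -normr_eq0 -sqrf_eq0 eq_le sqr_ge0 andbT.
  exact/ler_addgt0Pr.
(* Two errors [M * |x| * e'] add up: one from [g] against the simple function [s], the other from
   [z] against the integral of [s]. *)
move=> e0; pose K := 2 * (M * `|x|).
have K0 : 0 <= K by rewrite !mulr_ge0.
have K1 : 0 < K + 1 by rewrite ltr_wpDl.
pose e' := e / (K + 1); have e'0 : 0 < e' by rewrite divr_gt0.
have [p [A [a [mA mgs gs zs]]]] := hz e' e'0.
pose s (y : 'rV[R]_d) : V := \sum_i \1_(A i) y *: a i.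
have iA i : mu.-integrable setT (EFin \o (\1_(A i) : 'rV[R]_d -> R)).
  by apply: integrable_indic => //; rewrite ltey_eq fin_num_measure.
have fi i : mu.-integrable setT (EFin \o (fun y => ip (a i) x * \1_(A i) y)).
  by apply: integrable_EFinZl; exact: iA.
pose I := (\int[mu]_y (\sum_i ip (a i) x * \1_(A i) y))%R.
have IE : I = ip (\sum_i fine (mu (A i)) *: a i) x.
  rewrite /I Rintegral_sum// (bilinear_sum bip); apply: eq_bigr => i _.
  rewrite (RintegralZl _ measurableT (iA i)).
  by rewrite (bilinearZ bip) mulrC /Rintegral integral_indic// setIT.
have sx y : \sum_i ip (a i) x * \1_(A i) y = ip (s y) x.
  rewrite /s (bilinear_sum bip); apply: eq_bigr => i _.
  by rewrite (bilinearZ bip) mulrC.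
have Ile : `|I| <= M * `|x| * e'.
  have mk : measurable_fun setT (fun y => \sum_i ip (a i) x * \1_(A i) y).
    by apply/measurable_EFinP; case/integrableP: (integrable_EFin_sum (index_enum 'I_p) fi).
  have mgE : measurable_fun setT (fun y => (`|g y - s y|)%:E : \bar R).
    by apply/measurable_EFinP; exact: mgs.
  rewrite /I -lee_fin; apply: (@le_trans _ _ (\int[mu]_y `|(\sum_i ip (a i) x * \1_(A i) y)%:E|)%E).
    rewrite -abse_EFin /I /Rintegral fineK; last first.
      by apply: integrable_fin_num => //; exact: integrable_EFin_sum.
    by apply: le_abse_integral => //; exact/measurable_EFinP.
  apply: (@le_trans _ _ ((M * `|x|)%:E * \int[mu]_y (`|g y - s y|)%:E)%E); last first.
    by rewrite [leRHS]EFinM lee_wpmul2l ?lee_fin ?mulr_ge0//; exact: ltW.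
  rewrite -ge0_integralZl//; last by rewrite lee_fin mulr_ge0.
  apply: ge0_le_integral => //.
  - by apply: measurableT_comp => //; apply/measurable_EFinP.
  - exact: measurable_funeM.
  move=> y _; rewrite /= lee_fin sx.
  have -> : ip (s y) x = - ip (g y - s y) x.
    by rewrite (bilinearB bip) (ipx _ (gv y)) sub0r opprK.
  by rewrite normrN mulrAC hM.
have zle : `|ip z x - I| <= M * `|x| * e'.
  rewrite IE -(bilinearB bip) (le_trans (hM _ _))// mulrAC ler_wpM2l ?mulr_ge0//.
  exact: ltW.
have zx : ip z x = `|x| ^+ 2.
  rewrite -ip_norm {2}/x (bilinearB bip) [ip (\sum_i _) x]ipx ?subr0//.
  by exists c.
rewrite add0r -zx (le_trans (ler_norm _))// -(subrK I (ip z x)).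
rewrite (le_trans (ler_normD _ _))// (le_trans (lerD zle Ile))//.
apply: (@le_trans _ _ ((K + 1) * e')); last by rewrite /e' mulrCA divff ?mulr1 ?gt_eqF.
by rewrite mulrDl mul1r /K mulr_natl mulrnAl mulr2n lerDl ltW.
Qed.

(* The value [point] is taken by integrals that do not exist. *)
Lemma rank_le n (v : 'I_n -> V) (w : 'rV[R]_d -> V) : (point : V) = 0 ->
  (forall y, in_span v (w y)) -> (rank mu w <= n%:R%:E)%E.
Proof.
move=> pt0 wv; apply: ge_ereal_sup => _ [p [x [Sx ind]] <-].
rewrite lee_fin ler_nat; apply: (@lin_indep_in_span _ _ _ _ v x _ ind) => i.
have [phi _ <-] := Sx i; rewrite /Mop /bochner_integral.
case: xgetP => [z _ hz|_].
  apply: bochner_integral_in_span hz => y; exact: in_spanZ.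
by rewrite pt0; exists (fun=> 0); rewrite big1// => j _; rewrite scale0r.
Qed.

End bochner_span.

Section H10_inner_product.
Context {R : realType} {m : nat} {D : set 'rV[R]_m}.

Definition H10_dot (u v : H10 D) : R := jdot (jrepr (H10_jet u)) (jrepr (H10_jet v)).

Lemma H10_dotC u v : H10_dot u v = H10_dot v u.
Proof. exact: jdotC. Qed.

Lemma H10_dot_norm u : H10_dot u u = `|u| ^+ 2.
Proof. by rewrite /H10_dot -jnorm_sqr. Qed.

Lemma H10_dot_bilinear : bounded_bilinear H10_dot.
Proof.
split=> [t u u' v|]; last first.
  by exists 1 => // u v; rewrite mul1r; exact: jdot_le.
rewrite /H10_dot -jdotZl -jdotDl; apply: eq_jdotl.
by rewrite jclassD jclassZ !jreprK.
Qed.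

End H10_inner_product.

(** * Taylor coefficients *)

Definition index_seq d (nu : 'I_d -> nat) : seq 'I_d :=
  flatten [seq nseq (nu i) i | i <- enum 'I_d].

Lemma partial_nuE (R : realType) (V : normedModType R) d (u : 'rV[R]_d -> V) nu :
  partial_nu nu u = iter_partial u (index_seq nu).
Proof.
rewrite /partial_nu /iter_partial /index_seq.
elim: (enum 'I_d) => //= i s ->; rewrite foldr_cat.
by elim: (nu i) => //= n ->.
Qed.

Lemma count_index_seq d (nu : 'I_d -> nat) i : count_mem i (index_seq nu) = nu i.
Proof.
rewrite /index_seq count_flatten -map_comp sumnE big_map.
rewrite (eq_bigr (fun j => (j == i) * nu j)%N); last first.
  by move=> j _; rewrite /= count_nseq.
rewrite big_enum/= (bigD1 i)//= eqxx mul1n big1 ?addn0//.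
by move=> j /negbTE ->.
Qed.

Lemma size_index_seq d (nu : 'I_d -> nat) : size (index_seq nu) = (\sum_i nu i)%N.
Proof.
rewrite /index_seq size_flatten /shape -map_comp sumnE big_map big_enum.
by apply: eq_bigr => i _; rewrite /= size_nseq.
Qed.

Lemma size_count_mem d (s : seq 'I_d) : size s = (\sum_i count_mem i s)%N.
Proof.
elim: s => [|a s IH] /=; first by rewrite big1.
rewrite big_split /= -IH (bigD1 a)//= eqxx big1// => i /negbTE.
by rewrite eq_sym => ->.
Qed.

(** From (d + 1) C(k + d + 1, d + 1) = (k + d + 1) C(k + d, d) and k + d + 1 <= (d + 1)(k + 1). *)
Lemma ncoef_le d k : (ncoef d k <= (k + 1) ^ d)%N.
Proof.
rewrite /ncoef; elim: d => [|d IH]; first by rewrite addn0 bin0.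
rewrite -(leq_pmul2l (ltn0Sn d)) addnS -mul_bin_diag expnS mulnA.
by apply: leq_mul => //; nia.
Qed.

Section taylor_span.
Context (R : realType) (V : completeNormedModType R) (d : nat).
Variables (u : 'rV[R]_d.+1 -> V) (t : R) (k : nat).
Hypotheses (t0 : t != 0)
  (perm : forall s s', perm_eq s s' -> iter_partial u s 0 = iter_partial u s' 0)
  (euler : forall s, \sum_i iter_partial u (i :: s) 0 =
    (t * (size s).+1%:R) *: iter_partial u s 0).

(** The encoding by tuples is the one counted by [card_ord_partitions]; [d.+1] entries of sum [k]
    give [ncoef d k]. *)
Definition top_index : {set d.+1.-tuple 'I_k.+1} :=
  [set nu : d.+1.-tuple 'I_k.+1 | (\sum_(i <- nu) i)%N == k].

Lemma card_top_index : #|top_index| = ncoef d k.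
Proof. by rewrite card_ord_partitions /ncoef addnC. Qed.

Definition top_coef (l : 'I_(ncoef d k)) : V :=
  iter_partial u (index_seq (fun i =>
    tnth (enum_val (cast_ord (esym card_top_index) l)) i)) 0.

Lemma top_coef_onto s : size s = k -> exists l, iter_partial u s 0 = top_coef l.
Proof.
move=> sk; have cnt i : (count_mem i s < k.+1)%N by rewrite ltnS -sk count_size.
pose nu : d.+1.-tuple 'I_k.+1 := [tuple Ordinal (cnt i) | i < d.+1].
have nuA : nu \in top_index.
  rewrite inE big_tuple; apply/eqP; rewrite -[RHS]sk size_count_mem.
  by apply: eq_bigr => i _; rewrite tnth_mktuple.
exists (cast_ord card_top_index (enum_rank_in nuA nu)).
rewrite /top_coef cast_ordK enum_rankK_in//; apply: perm.
apply/allP => i _ /=; rewrite count_index_seq tnth_mktuple/=; exact/eqP.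
Qed.

(* Downward induction on the order: by Euler's identity the partials of order j
   are sums of partials of order j + 1. *)
Lemma iter_partial_in_span s : (size s <= k)%N ->
  in_span top_coef (iter_partial u s 0).
Proof.
move=> sk; have [n] := ubnP (k - size s); elim: n s sk => // n IH s sk.
have [/top_coef_onto[l ->]|sk' kn] := eqVneq (size s) k.
  by move=> _; exact: in_span_gen.
have {}sk : (size s < k)%N by rewrite ltn_neqAle sk' sk.
have c0 : t * (size s).+1%:R != 0 by rewrite mulf_neq0// pnatr_eq0.
rewrite -[iter_partial u s 0](scalerK c0) -euler; apply: in_spanZ.
apply: in_span_sum => i _; apply: IH => //=.
by move: kn; rewrite -subn_gt0 in sk; lia.
Qed.

Lemma taylor_trunc_polynomial :
  exists phi : 'I_(ncoef d k) -> mpoly.mpoly d.+1 R, forall y,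
    taylor_trunc u k y = \sum_l mpoly.meval (fun i => y ord0 i) (phi l) *: top_coef l.
Proof.
have /choice[C hC] : forall nu : {ffun 'I_d.+1 -> 'I_k.+1},
    exists c : 'I_(ncoef d k) -> R, (\sum_i nu i <= k)%N ->
      taylor_coef u (fun i => nu i) = \sum_l c l *: top_coef l.
  move=> nu; have [nuk|_] := boolP (\sum_i nu i <= k)%N; last by exists (fun=> 0).
  rewrite /taylor_coef partial_nuE.
  have [|c ->] := @iter_partial_in_span (index_seq (fun i => nu i)).
    by rewrite size_index_seq.
  exists (fun l => (\prod_i (nu i)`!)%:R^-1 * c l) => _.
  by rewrite scaler_sumr; apply: eq_bigr => l _; rewrite scalerA.
(* Each monomial is weighted by the coordinate along [top_coef l] of its Taylor coefficient. *)
exists (fun l => \sum_(nu : {ffun 'I_d.+1 -> 'I_k.+1} | (\sum_i nu i <= k)%N)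
  C nu l *: \prod_(i < d.+1) (mpoly.mpolyX R (mpoly.mnm1 i) : mpoly.mpoly d.+1 R) ^+ nu i)
  => y.
rewrite /taylor_trunc; under eq_bigr => nu hnu do rewrite hC// scaler_sumr.
rewrite exchange_big /=; apply: eq_bigr => l _.
rewrite raddf_sum /= scaler_suml; apply: eq_bigr => nu _.
rewrite mpoly.mevalZ rmorph_prod/= scalerA mulrC; congr (_ * _ *: _).
by apply: eq_bigr => i _; rewrite rmorphXn /= mpoly.mevalXU.
Qed.

End taylor_span.

Theorem proposition3p2 (R : realType) (m d : nat) (hm : (0 < m)%N)
    (hd : (0 < d)%N) (D : set 'rV[R]_m) (hD : is_domain D)
    (bD : bounded_set D) (abar : 'rV[R]_m -> R)
    (psi : 'I_d -> 'rV[R]_m -> R) (habar : Linfty D abar)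
    (hpsi : forall i, Linfty D (psi i)) (lo hi : R) (hlo : 0 < lo)
    (hlohi : lo <= hi)
    (hell : forall x y, D x -> cube y -> lo <= affine_coef abar psi y x <= hi)
    (f : {linear H10 D -> R}) (hf : continuous f) (u : 'rV[R]_d -> H10 D)
    (hu : forall y, cube y -> forall v,
      diffusion abar (u y) v - \sum_i y ord0 i * diffusion (psi i) (u y) v = f v)
    (theta : R) (htheta : 0 < theta < 1)
    (hsum : forall w v,
      \sum_i diffusion (psi i) w v = theta * @diffusion R m D abar w v)
    (mu : probability 'rV[R]_d R) (hmu : mu (@cube R d) = 1%E) (k : nat) :
  (exists (v : 'I_(ncoef d.-1 k) -> H10 D)
          (phi : 'I_(ncoef d.-1 k) -> mpoly.mpoly d R),
      forall y, cube y ->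
        taylor_trunc u k y = \sum_l mpoly.meval (fun i => y ord0 i) (phi l) *: v l)
  /\ (rank mu (taylor_trunc u k) <= (ncoef d.-1 k)%:R%:E)%E
  /\ (ncoef d.-1 k <= (k + 1) ^ d.-1)%N.
Proof.
case: m hm D hD bD abar psi habar hpsi hell f hf u hu hsum => // n _ D hD bD.
case: d hd mu hmu => // d _ mu hmu abar psi habar hpsi hell f hf u hu hsum.
(* [bounded_set] bounds the norm by every number above [M]: [|M| + 1] is one, and a further unit
   makes the inequality strict. *)
have [L L0 DL] : exists2 L, 0 < L & forall x, D x -> `|x| < L.
  have [M [_ hM]] := bD; exists (`|M| + 2); first by rewrite ltr_wpDl.
  move=> x Dx; apply: le_lt_trans (hM (`|M| + 1) _ x Dx) _.
    by rewrite (le_lt_trans (ler_norm M))// ltrDl.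
  by rewrite ltrD2l; lra.
pose c := lo / (1 + 4 * L ^+ 2).
have c0 : 0 < c by rewrite divr_gt0// ltr_wpDr// mulr_ge0// sqr_ge0.
have coer y : cube y -> forall w : H10 D, c * `|w| ^+ 2 <=
    diffusion abar w w - \sum_i y ord0 i * diffusion (psi i) w w.
  move=> hy w; apply: diffusion_coercive => // x Dx.
  by case/andP: (hell x y Dx hy).
have ba := diffusion_bounded_bilinear habar.
have bb i := diffusion_bounded_bilinear (hpsi i).
have O0 := @open_cube0 R d.+1.
have perm s s' : perm_eq s s' -> iter_partial u s 0 = iter_partial u s' 0.
  move=> ss; have [_ P _] := iter_partial_weak ba bb c0 coer hu s.
  exact: P.
have euler := iter_partial_euler ba bb c0 coer hu hsum.
have theta0 : theta != 0 by case/andP: htheta => /gt_eqF ->.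
have [phi hphi] := taylor_trunc_polynomial k theta0 perm euler.
split; first by exists (@top_coef _ _ _ u k), phi => y _; exact: hphi.
split; last exact: ncoef_le.
have wv y : in_span (@top_coef _ _ _ u k) (taylor_trunc u k y).
  by exists (fun l => mpoly.meval (fun i => y ord0 i) (phi l)).
exact: (rank_le H10_dot_bilinear H10_dotC H10_dot_norm _ _ wv).
Qed.
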